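(* For any finite simplicial poset $\mathcal{S}$, there exist a finite simplicial complex $\mathcal{K}$ and a partition $\alpha$ of the vertex set $V(\mathcal{K})$ such that the moment-angle complex $\mathcal{Z}_{\mathcal{S}}$ is homotopy equivalent to $X(\mathcal{K},\lambda_\alpha)$.
   Context: A poset $\mathcal{S}$ with order $\le$ is called simplicial if it has an initial element $\hat 0$ and for each $\sigma\in\mathcal{S}$ the lower segment $[\hat 0,\sigma]=\{\tau\in\mathcal{S}:\hat0\le\tau\le\sigma\}$ is the face poset of a simplex (including the empty face). Gluing geometric simplices $\Delta^\sigma$ (with face poset $[\hat0,\sigma]$), $\sigma \in \mathcal{S}$, along the order relation gives a cell complex $\Delta^{\mathcal{S}}$, the geometric realization of $\mathcal{S}$; its vertices $u_1,\dots,u_k$ are the elements of $\mathcal{S}$ whose lower segment is the face poset of a point. Moment-angle complex of $\mathcal{S}$: let $P_{\mathcal{S}}$ be the cone on the barycentric subdivision of $\Delta^{\mathcal{S}}$, i.e. the geometric realization of the order complex of $\mathcal{S}$ (with $\hat 0$ corresponding to the cone point), and for $\sigma\in\mathcal{S}$ let $F_\sigma\subset P_{\mathcal{S}}$ be the realization of the order complex of $\{\tau\in\mathcal{S}:\tau\ge\sigma\}$. Let $\lambda_{\mathcal{S}}:\{u_1,\dots,u_k\}\to\mathbb{Z}^k$ be a map such that $\{\lambda_{\mathcal{S}}(u_i)\}_{1\le i\le k}$ is a basis of $\mathbb{Z}^k$, and let $G_{\lambda_{\mathcal{S}}}(\sigma)\subset T^k=(S^1)^k$ be the subtorus corresponding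 to the subgroup of $\mathbb{Z}^k$ generated by the $\lambda_{\mathcal{S}}(u)$ with $u$ a vertex of $\sigma$ (i.e. $u\le\sigma$). Then $\mathcal{Z}_{\mathcal{S}}=P_{\mathcal{S}}\times T^k/\sim$, where $(p,g)\sim(p',g')$ whenever $p=p'\in F_\sigma$ and $g'g^{-1}\in G_{\lambda_{\mathcal{S}}}(\sigma)$ for some $\sigma\in\mathcal{S}$. The space $X(\mathcal{K},\lambda_{\alpha})$: a simplicial complex $\mathcal{K}$ is a collection of subsets (simplices) of a vertex set $V(\mathcal{K})$, closed under subsets and containing the empty simplex; $V(\sigma)$ is the vertex set of $\sigma$. A partition $\alpha=\{\alpha_1,\dots,\alpha_k\}$ of $V(\mathcal{K})$ consists of disjoint subsets with union $V(\mathcal{K})$. Let $P_{\mathcal{K}}$ be the cone on the barycentric subdivision of $\mathcal{K}$, i.e. the geometric realization of the order complex of the poset of all simplices of $\mathcal{K}$ including the empty one, and let $F_\sigma\subset P_{\mathcal{K}}$ be the realization of the order complex of $\{\tau\in\mathcal{K}:\sigma\subseteq\tau\}$. Let $\{\tilde e_1,\dots,\tilde e_k\}$ be a basis of $\mathbb{Z}^k$, let $\lambda_\alpha:V(\mathcal{K})\to\mathbb{Z}^k$ send every vertex of $\alpha_i$ to $\tilde e_i$, and let $G_{\lambda_\alpha}(\sigma)\subset T^k$ be the subtorus corresponding to the subgroup of $\mathbb{Z}^k$ generated by $\{\lambda_\alpha(v):v\in V(\sigma)\}$. Then $X(\mathcal{K},\lambda_\alpha)=P_{\mathcal{K}}\times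 T^k/\sim$, where $(p,g)\sim(p',g')$ whenever $p=p'\in F_\sigma$ and $g'g^{-1}\in G_{\lambda_\alpha}(\sigma)$ for some $\sigma\in\mathcal{K}$. *)

(* Defs.v *)
From HB Require Import structures.
From mathcomp Require Import all_boot all_order all_algebra generic_quotient.
From mathcomp Require Import complex.
From mathcomp Require Import all_classical reals topology normedtype.

Set Implicit Arguments.
Unset Strict Implicit.
Unset Printing Implicit Defensive.

Import Order.TTheory GRing.Theory Num.Theory.
Import numFieldNormedType.Exports.

Local Open Scope classical_set_scope.
Local Open Scope ring_scope.

(* The face poset of a simplex on n vertices, empty face included, is the
   power set of 'I_n ordered by inclusion. *)
Definition segment_is_simplex d (S : finBPOrderType d) (n : nat) (s : S) :=
  exists f : {set 'I_n} -> S,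
    (forall A B : {set 'I_n}, (f A <= f B)%O = (A \subset B)) /\
    (forall t : S, (\bot <= t <= s)%O <-> exists A, f A = t).

Definition simplicial_poset d (S : finBPOrderType d) :=
  forall s : S, exists n, segment_is_simplex n s.

Definition poset_vertices d (S : finBPOrderType d) : {set S} :=
  [set u | `[< segment_is_simplex 1 u >]].

Definition poset_vertex d (S : finBPOrderType d) :=
  {u : S | u \in poset_vertices S}.
HB.instance Definition _ d (S : finBPOrderType d) :=
  SubFinite.on (poset_vertex S).

Definition vertices_of d (S : finBPOrderType d) (s : S) :
    {set poset_vertex S} :=
  [set u | (val u <= s)%O].

Record simplicial_complex (V : finType) := SimplicialComplex {
  simplices :> {set {set V}};
  empty_simplex : finset.set0 \in simplices;
  sub_simplex : forall A B : {set V},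
    A \subset B -> B \in simplices -> A \in simplices }.

Definition simplex (V : finType) (K : simplicial_complex V) :=
  {A : {set V} | A \in simplices K}.
HB.instance Definition _ V (K : simplicial_complex V) :=
  SubFinite.on (simplex K).

Fact simplex_display : Order.disp_t. Proof. exact: Order.Disp tt tt. Qed.

Section SimplexOrder.
Variables (V : finType) (K : simplicial_complex V).
Implicit Types A B : simplex K.

Definition simplex_le A B := val A \subset val B.

Lemma simplex_le_refl : reflexive simplex_le.
Proof. by move=> A; exact: subxx. Qed.

Lemma simplex_le_anti : antisymmetric simplex_le.
Proof.
by move=> A B /andP[AB BA]; apply/val_inj/eqP; rewrite finset.eqEsubset; apply/andP.
Qed.

Lemma simplex_le_trans : transitive simplex_le.
Proof. by move=> B A C; exact: fintype.subset_trans. Qed.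

HB.instance Definition _ := Order.Le_isPOrder.Build simplex_display (simplex K)
  simplex_le_refl simplex_le_anti simplex_le_trans.
End SimplexOrder.

(* R[i] itself carries no topology in the library; a generic numeric field
   does. *)
Definition Cplx (R : realType) : numClosedFieldType := R[i].

Section Torus.
Variables (R : realType) (k : nat).
Local Notation Ck := 'rV[Cplx R]_k.

Definition torus : set Ck := [set g | forall j, `|g 0 j| = 1].

Definition tone : Ck := const_mx 1.
Definition tdiv (g h : Ck) : Ck := \row_j (g 0 j / h 0 j).

Definition tsubgroup (H : set Ck) :=
  [/\ H `<=` torus, H tone & forall g h, H g -> H h -> H (tdiv g h)].

Definition cocharacter (m : 'rV[int]_k) (z : Cplx R) : Ck :=
  \row_j z ^ (m 0 j).

Definition gen_tsubgroup (A : set Ck) : set Ck := smallest tsubgroup A.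

(* T^k = Z^k (x) S^1; the subtorus of L <= Z^k is the image of L (x) S^1, that
   is, the subgroup generated by the one-parameter subgroups of the elements
   of L. *)
Definition subtorus (L : set 'rV[int]_k) : set Ck :=
  gen_tsubgroup
    [set g | exists2 m, L m & exists2 z, `|z| = 1 & g = cocharacter m z].

Lemma torus_tsubgroup : tsubgroup torus.
Proof.
split=> // [j|g h gT hT j]; first by rewrite mxE normr1.
by rewrite mxE normrM normfV gT hT invr1 mulr1.
Qed.

Lemma cocharacter_torus m z : `|z| = 1 -> torus (cocharacter m z).
Proof.
move=> z1 j; rewrite mxE; case: (m 0 j) => n.
  by rewrite -exprnP normrX z1 expr1n.
by rewrite NegzE -exprnN normfV normrX z1 expr1n invr1. Qed.

Lemma gen_tsubgroupP A : A `<=` torus -> tsubgroup (gen_tsubgroup A).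
Proof.
move=> AT; split.
- by move=> g; apply; split => //; exact: torus_tsubgroup.
- by move=> H [[]].
- by move=> g h gA hA H HA; case: (HA) => -[_ _ Hd] _; apply: Hd;
    [exact: gA|exact: hA].
Qed.

Lemma subtorus_tsubgroup L : tsubgroup (subtorus L).
Proof.
by apply: gen_tsubgroupP => _ [m _ [z z1 ->]]; exact: cocharacter_torus.
Qed.

Lemma subtorusS (L M : set 'rV[int]_k) : L `<=` M -> subtorus L `<=` subtorus M.
Proof.
move=> LM g gL H [HS MH]; apply: gL; split => //.
by move=> _ [m Lm [z z1 ->]]; apply: MH; exists m; [exact: LM|exists z].
Qed.

End Torus.

Definition gen_subgroup (W : zmodType) (A : set W) : set W :=
  smallest (fun H => H 0 /\ forall x y, H x -> H y -> H (x - y)) A.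

Definition Zbasis (I : finType) (k : nat) (b : I -> 'rV[int]_k) :=
  forall x, exists! c : {ffun I -> int}, x = \sum_i c i *: b i.

(* G_lambda of a simplex with vertex set A. *)
Definition isotropy (R : realType) (k : nat) (V : finType)
    (lambda : V -> 'rV[int]_k) (A : {set V}) : set 'rV[Cplx R]_k :=
  subtorus (gen_subgroup [set lambda v | v in [set` A]]).
Arguments isotropy R {k V} lambda A _.

Lemma isotropy_tsubgroup (R : realType) (k : nat) (V : finType)
    (lambda : V -> 'rV[int]_k) (A : {set V}) :
  tsubgroup (isotropy R lambda A).
Proof. exact: subtorus_tsubgroup. Qed.

Lemma isotropyS (R : realType) (k : nat) (V : finType)
    (lambda : V -> 'rV[int]_k) (A B : {set V}) :
  A \subset B -> isotropy R lambda A `<=` isotropy R lambda B.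
Proof.
move=> /fintype.subsetP AB; apply: subtorusS => x xA H [HS BH]; apply: xA; split => //.
by move=> _ [v vA <-]; apply: BH; exists v => //; exact: AB.
Qed.

Section OrderComplex.
Variables (R : realType) (d : Order.disp_t) (T : finPOrderType d).

(* Barycentric coordinates on the geometric realization of the order complex
   of T: the support of a point is a nonempty chain. *)
Definition realization : set {ptws T -> R} :=
  [set x | [/\ forall t, 0 <= x t,
               \sum_t x t = 1 &
               forall s t, x s != 0 -> x t != 0 -> (s >=< t)%O]].

(* The realization of the order complex of the elements above s. *)
Definition dual_face (s : T) : set {ptws T -> R} :=
  [set x | realization x /\ forall t, x t != 0 -> (s <= t)%O].

Lemma dual_face_join (x : {ptws T -> R}) : realization x ->
  exists m, dual_face m x /\ forall s, dual_face s x -> (s <= m)%O.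
Proof.
move=> xP; case: (xP) => x0 x1 xc.
have [s0 xs0] : exists s, x s != 0.
  apply/existsP; apply: contraTT isT; rewrite negb_exists => /forallP xN.
  move: x1; rewrite big1 => [|t _]; last by apply/eqP; rewrite -[_ == _]negbK xN.
  by move/esym/eqP; rewrite oner_eq0.
pose below (s : T) := [set t : T | (t <= s)%O]%SET.
case: (@arg_minnP _ s0 (fun s => x s != 0) (fun s => #|below s|) xs0) => m xm mmin.
exists m; split; last by move=> s [_]; exact.
split=> // t xt; have /orP[//|tm] := xc _ _ xm xt.
have sub : below t \subset below m.
  by apply/fintype.subsetP => u; rewrite !inE => /le_trans; apply.
have /eqP bE : below t == below m by rewrite eqEcard sub mmin.
have : m \in below m by rewrite inE.
by rewrite -bE inE.
Qed.

End OrderComplex.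

Section IdentificationSpace.
Variables (R : realType) (d : Order.disp_t) (T : finPOrderType d) (k : nat).
Variable G : T -> set 'rV[Cplx R]_k.
Hypothesis G_subgroup : forall s, tsubgroup (G s).
Hypothesis G_mono : forall s t, (s <= t)%O -> G s `<=` G t.

Definition prespace : Type :=
  (set_type (@realization R d T) * set_type (@torus R k))%type.
HB.instance Definition _ := Topological.on prespace.

Definition torus_glue (a b : prespace) : bool :=
  `[< a.1 = b.1 /\ exists s, dual_face s (val a.1) /\
        G s (tdiv (val b.2) (val a.2)) >].

Lemma glue_refl : reflexive torus_glue.
Proof.
move=> [p g]; apply/asboolP; split => //=.
have [m [mp _]] := dual_face_join (set_valP p).
exists m; split=> //; have [_ G1 _] := G_subgroup m.
rewrite (_ : tdiv _ _ = tone R k)//; apply/rowP => j; rewrite !mxE divff//.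
by rewrite -normr_gt0 (set_valP g j) ltr01.
Qed.

Lemma glue_sym : symmetric torus_glue.
Proof.
suff H a b : torus_glue a b -> torus_glue b a by move=> a b; apply/idP/idP; exact: H.
case: a b => [p g] [q h] /asboolP[/= <- [s [sp Gs]]].
apply/asboolP; split => //=; exists s; split => //.
have [_ G1 Gd] := G_subgroup s; have := Gd _ _ G1 Gs; congr G.
by apply/rowP => j; rewrite !mxE invf_div mul1r.
Qed.

Lemma glue_trans : transitive torus_glue.
Proof.
move=> [q h] [p g] [r l] /asboolP[/= <- [s [sp Gs]]] /asboolP[/= <- [t [tp Gt]]].
apply/asboolP; split => //=.
have [m [mp mmax]] := dual_face_join (set_valP p).
exists m; split => //; have [_ G1 Gd] := G_subgroup m.
have {}Gs := G_mono (mmax _ sp) Gs; have {}Gt := G_mono (mmax _ tp) Gt.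
have := Gd _ _ Gt (Gd _ _ G1 Gs); congr G; apply/rowP => j.
rewrite !mxE mul1r invrK mulrA divfK//.
by rewrite -normr_gt0 (set_valP h j) ltr01.
Qed.

Canonical glue_equiv := EquivRel torus_glue glue_refl glue_sym glue_trans.

Definition identification_space : topologicalType :=
  quotient_topology {eq_quot glue_equiv}%qT.

End IdentificationSpace.

Lemma vertices_ofS d (S : finBPOrderType d) (s t : S) :
  (s <= t)%O -> vertices_of s \subset vertices_of t.
Proof.
by move=> st; apply/fintype.subsetP => u; rewrite !inE => /le_trans; exact.
Qed.

Definition moment_angle_complex (R : realType) d (S : finBPOrderType d) (k : nat)
    (lambda : poset_vertex S -> 'rV[int]_k) : topologicalType :=
  @identification_space R d S k (fun s => isotropy R lambda (vertices_of s))
    (fun s => isotropy_tsubgroup _ _ _)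
    (fun s t st => isotropyS (vertices_ofS st)).

Definition X_space (R : realType) (V : finType) (K : simplicial_complex V)
    (k : nat) (lambda : V -> 'rV[int]_k) : topologicalType :=
  @identification_space R _ (simplex K) k (fun s => isotropy R lambda (val s))
    (fun s => isotropy_tsubgroup _ _ _)
    (fun s t => @isotropyS R k V lambda (val s) (val t)).

Definition homotopic (R : realType) (X Y : topologicalType) (f g : X -> Y) :=
  exists H : X * R -> Y,
    [/\ {within [set p | p.2 \in `[0, 1]], continuous H},
        forall x, H (x, 0) = f x & forall x, H (x, 1) = g x].

Definition homotopy_equivalent (R : realType) (X Y : topologicalType) :=
  exists (f : X -> Y) (g : Y -> X),
    [/\ continuous f, continuous g, homotopic R (g \o f) id &
        homotopic R (f \o g) id].

(* Main.v *)
From HB Require Import structures.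
Require Import Defs.
From mathcomp Require Import all_boot all_order all_algebra generic_quotient.
From mathcomp Require Import complex lra.
From mathcomp Require Import all_classical reals topology normedtype.
From mathcomp Require Import function_spaces.

Set Implicit Arguments.
Unset Strict Implicit.
Unset Printing Implicit Defensive.

Import Order.TTheory GRing.Theory Num.Theory.
Import numFieldNormedType.Exports.

Local Open Scope classical_set_scope.
Local Open Scope ring_scope.

(** For s in S let c s be the set of vertices below s. The vertices of K are the
    pairs (u, s) with u in c s; such a pair has colour u and height s. A set of
    pairs is a simplex of K if their heights form a chain, and alpha is the
    partition of the vertices by colour. Thus K arises from the order complex of
    S by replacing each element s with a simplex on the vertex set c s.

    Both spaces have the form P * T^k / ~ with P the realization of a poset, and
    the isotropy over a point of P is the torus of the colours of the smallest
    element of its support. A map between realizations, times the identity of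
    the torus, descends to the quotients provided that it loses no colours
    (keeps_labels), and likewise for homotopies (identification_equivalence). The
    two tori are identified by the integer matrices that exchange the two given
    bases (Zbasis_mulmx, isotropy_tpow). It remains to find maps between the
    realizations of S and of K that lose no colours, and homotopies between their
    composites and the identities that lose no colours either.

    From K to S one sends a simplex to its largest height (from_flags); this is
    monotone, and all colours of the simplex lie below that height. In the other
    direction s |-> {(u, s) : u in c s} is not monotone. But a point x of the
    realization of S is supported on a chain, its superlevel sets D are nested
    subchains, and D |-> {(u, s) : s in D, u in c s} is monotone in D. Weighting the
    superlevel sets by quantities that depend continuously on x and vanish when D
    stops being a superlevel set gives to_flags.

    Going from S to K and back moves x within the simplex spanned by the chain
    supporting x and \bot, so a straight line joins it to x
    (from_to_flags_homotopic). Starting from K, the identity is first deformed to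
    the map fill which adds to each simplex all pairs having one of its heights;
    this is the homotopy attached to a pair of comparable monotone maps. Next, let
    spread x be the point of the realization of S that distributes the mass of each
    simplex among its heights: its superlevel sets are the sets of heights of the
    simplices supporting x, whence fill is homotopic to to_flags composed with spread
    (fill_spread_homotopic). Finally spread is deformed linearly to from_flags, which
    after composition with to_flags loses no colours
    (spread_from_flags_homotopic). *)

(** * Continuity into product, matrix and subset topologies *)

Lemma continuous_ptws (X : topologicalType) (I : Type) (Y : topologicalType)
    (f : X -> {ptws I -> Y}) :
  (forall i, continuous (fun x => f x i)) -> continuous f.
Proof.
move=> cf x; apply/cvg_sup => i.
have H := @continuous_comp_initial {ptws I -> Y} X Y
  (fun g : {ptws I -> Y} => g i) f (cf i) x.
exact: H.
Qed.

Lemma continuous_mx (X Y : topologicalType) m n (f : X -> 'M[Y]_(m, n)) :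
  (forall i j, continuous (fun x => f x i j)) -> continuous f.
Proof.
move=> cf x A [P fP PA]; rewrite nbhs_simpl.
have : \forall y \near x, forall i, forall j, P i j (f y i j).
  by apply: filter_forall => i; apply: filter_forall => j; exact: cf.
by apply: filterS => y Py; exact: PA.
Qed.

Lemma continuous_set_type (X Y : topologicalType) (A : set Y)
    (f : X -> set_type A) :
  continuous (fun x => set_val (f x)) -> continuous f.
Proof. exact: continuous_comp_initial. Qed.

Lemma continuous_set_val (Y : topologicalType) (A : set Y) :
  continuous (set_val : set_type A -> Y).
Proof. exact: initial_continuous. Qed.

Lemma continuous_pair (X Y Z : topologicalType) (f : X -> Y) (g : X -> Z) :
  continuous f -> continuous g -> continuous (fun x => (f x, g x)).
Proof. by move=> cf cg x; apply: cvg_pair; [exact: cf | exact: cg]. Qed.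

Lemma continuous_compose (X Y Z : topologicalType) (g : Y -> Z) (f : X -> Y) :
  continuous g -> continuous f -> continuous (fun x => g (f x)).
Proof. by move=> cg cf x; apply: continuous_comp; [exact: cf | exact: cg]. Qed.

Lemma continuous_fst (X Y : topologicalType) : continuous (@fst X Y).
Proof. by move=> x; exact: cvg_fst. Qed.

Lemma continuous_snd (X Y : topologicalType) : continuous (@snd X Y).
Proof. by move=> x; exact: cvg_snd. Qed.

Section RealValued.
Variables (R : realType) (X : topologicalType).
Implicit Types f g : X -> R.

Lemma continuous_realD f g :
  continuous f -> continuous g -> continuous (fun x => f x + g x).
Proof. by move=> cf cg x; apply: continuousD; [exact: cf | exact: cg]. Qed.

Lemma continuous_realB f g :
  continuous f -> continuous g -> continuous (fun x => f x - g x).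
Proof. by move=> cf cg x; apply: continuousB; [exact: cf | exact: cg]. Qed.

Lemma continuous_realM f g :
  continuous f -> continuous g -> continuous (fun x => f x * g x).
Proof. by move=> cf cg x; apply: continuousM; [exact: cf | exact: cg]. Qed.

Lemma continuous_realV f :
  (forall x, f x != 0) -> continuous f -> continuous (fun x => (f x)^-1).
Proof. by move=> f0 cf x; apply: continuousV; [exact: f0 | exact: cf]. Qed.

Lemma continuous_real_max f g :
  continuous f -> continuous g -> continuous (fun x => Num.max (f x) (g x)).
Proof. by move=> cf cg x; apply: continuous_max; [exact: cf | exact: cg]. Qed.

Lemma continuous_real_min f g :
  continuous f -> continuous g -> continuous (fun x => Num.min (f x) (g x)).
Proof. by move=> cf cg x; apply: continuous_min; [exact: cf | exact: cg]. Qed.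

Lemma continuous_real_sum (I : finType) (P : pred I) (f : I -> X -> R) :
  (forall i, continuous (f i)) -> continuous (fun x => \sum_(i | P i) f i x).
Proof.
by move=> cf; apply: continuous_big; [exact: add_continuous | move=> i _; exact: cf].
Qed.

Lemma continuous_real_prod (I : finType) (P : pred I) (f : I -> X -> R) :
  (forall i, continuous (f i)) -> continuous (fun x => \prod_(i | P i) f i x).
Proof.
by move=> cf; apply: continuous_big; [exact: mul_continuous | move=> i _; exact: cf].
Qed.

End RealValued.

(** * Realizations of order complexes *)

Section ChainExtrema.
Variables (d : Order.disp_t) (T : finPOrderType d) (Q : pred T).
Hypothesis Q_chain : forall s t, Q s -> Q t -> (s >=< t)%O.
Let below s := [set t : T | (t <= s)%O]%SET.

Lemma below_eq s t : (s <= t)%O -> (#|below t| <= #|below s|)%N -> s = t.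
Proof.
move=> st ts; apply/eqP; rewrite eq_le st /=.
have sub : below s \subset below t.
  by apply/fintype.subsetP => u; rewrite !inE => /le_trans; apply.
have /eqP bE : below s == below t by rewrite eqEcard sub.
have : t \in below t by rewrite inE.
by rewrite -bE inE.
Qed.

Lemma chain_min s0 : Q s0 -> exists m, Q m /\ forall t, Q t -> (m <= t)%O.
Proof.
move=> Q0; case: (@arg_minnP _ s0 Q (fun s => #|below s|) Q0) => m Qm mmin.
exists m; split=> // t Qt; have /orP[//|tm] := Q_chain Qm Qt.
by rewrite (below_eq tm (mmin t Qt)).
Qed.

Lemma chain_max s0 : Q s0 -> exists m, Q m /\ forall t, Q t -> (t <= m)%O.
Proof.
move=> Q0; case: (@arg_maxnP _ s0 Q (fun s => #|below s|) Q0) => m Qm mmax.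
exists m; split=> // t Qt; have /orP[mt|//] := Q_chain Qm Qt.
by rewrite (below_eq mt (mmax t Qt)).
Qed.

End ChainExtrema.

Notation realization_space R T := (set_type (@realization R _ T)).

Section BarycentricCoordinates.
Variables (R : realType) (d : Order.disp_t) (T : finPOrderType d).
Local Notation P := (realization_space R T).
Implicit Types (x : P) (s t : T).

Definition coord x t : R := set_val x t.

Lemma coord_ge0 x t : 0 <= coord x t.
Proof. by case: (set_valP x). Qed.

Lemma sum_coord x : \sum_t coord x t = 1.
Proof. by case: (set_valP x). Qed.

Lemma coord_chain x s t : coord x s != 0 -> coord x t != 0 -> (s >=< t)%O.
Proof. by case: (set_valP x) => _ _; exact. Qed.

Lemma coord_inj x y : (forall t, coord x t = coord y t) -> x = y.
Proof. by move=> xy; apply: val_inj; apply/funext => t; exact: xy. Qed.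

Lemma continuous_coord t : continuous (coord ^~ t).
Proof.
move=> x; apply: (@continuous_comp _ _ _ set_val (fun g : {ptws T -> R} => g t)).
  exact: continuous_set_val.
exact: proj_continuous.
Qed.

Lemma coord_neq0_ex x : exists t, coord x t != 0.
Proof.
apply/existsP; apply: contraTT isT; rewrite negb_exists => /forallP x0.
have /eqP := sum_coord x; rewrite big1 => [|t _]; first by rewrite eq_sym oner_eq0.
by apply/eqP; rewrite -[_ == _]negbK x0.
Qed.

Lemma coord_gt0 x t : coord x t != 0 -> 0 < coord x t.
Proof. by move=> xt; rewrite lt0r xt coord_ge0. Qed.

(** The support of a point is a nonempty finite chain. *)
Lemma coord_min x :
  exists2 m, coord x m != 0 & forall t, coord x t != 0 -> (m <= t)%O.
Proof.
have [s0 xs0] := coord_neq0_ex x.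
by have [m []] := chain_min (@coord_chain x) xs0; exists m.
Qed.

Definition point_of (f : {ptws T -> R}) (fP : realization f) : P :=
  exist _ f (mem_set fP).

Lemma coord_point_of (f : {ptws T -> R}) (fP : realization f) t :
  coord (point_of fP) t = f t.
Proof. by []. Qed.

Lemma continuous_to_realization (X : topologicalType) (f : X -> P) :
  (forall t, continuous (fun y => coord (f y) t)) -> continuous f.
Proof. by move=> cf; apply: continuous_set_type; exact: continuous_ptws. Qed.

End BarycentricCoordinates.

(** Every map into a realization is given by continuous nonnegative weights
    attached to elements of the poset; dividing by the total weight spares the
    constructions below from having weights that add up to one. *)
Section Weights.
Variables (R : realType) (X : topologicalType) (I : finType).
Variables (d : Order.disp_t) (T : finPOrderType d).
Variables (w : I -> X -> R) (l : I -> T).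
Hypothesis w_ge0 : forall i x, 0 <= w i x.
Hypothesis w_neq0 : forall x, exists i, w i x != 0.
Hypothesis w_chain : forall x i j, w i x != 0 -> w j x != 0 -> (l i >=< l j)%O.

Lemma weight_total_gt0 x : 0 < \sum_i w i x.
Proof.
have [i wi] := w_neq0 x; rewrite (bigD1 i)//= ltr_wpDr ?sumr_ge0//.
by rewrite lt0r wi w_ge0.
Qed.

Definition weighted_coord x : {ptws T -> R} :=
  fun t => (\sum_(i | l i == t) w i x) / \sum_i w i x.

Lemma weighted_coord_neq0 x t :
  weighted_coord x t != 0 -> exists2 i, l i = t & w i x != 0.
Proof.
rewrite /weighted_coord => /eqP H.
have [/existsP[i /andP[/eqP li wi]]|] := boolP [exists i, (l i == t) && (w i x != 0)].
  by exists i.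
rewrite negb_exists => /forallP w0; case: H; rewrite big1 ?mul0r// => i li.
by apply/eqP; have := w0 i; rewrite li /= negbK.
Qed.

Lemma weighted_realization x : realization (weighted_coord x).
Proof.
split.
- by move=> t; rewrite divr_ge0 ?sumr_ge0.
- rewrite -mulr_suml [X in X / _](_ : _ = \sum_i w i x) ?divff//.
    by rewrite gt_eqF ?weight_total_gt0.
  by rewrite (partition_big l predT).
- move=> s t /weighted_coord_neq0[i <- wi] /weighted_coord_neq0[j <- wj].
  exact: w_chain wi wj.
Qed.

Definition weighted_map x : realization_space R T :=
  point_of (weighted_realization x).

Lemma coord_weighted x t : coord (weighted_map x) t = weighted_coord x t.
Proof. by []. Qed.

Lemma weighted_map_neq0 x t :
  coord (weighted_map x) t != 0 -> exists2 i, l i = t & w i x != 0.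
Proof. exact: weighted_coord_neq0. Qed.

Lemma continuous_weighted :
  (forall i, continuous (w i)) -> continuous weighted_map.
Proof.
move=> cw; apply: continuous_to_realization => t.
apply: continuous_realM; first exact: continuous_real_sum.
apply: continuous_realV; last exact: continuous_real_sum.
by move=> x; rewrite gt_eqF ?weight_total_gt0.
Qed.

End Weights.

(** * Homotopies between realizations *)

Definition clamp (R : realType) (t : R) : R := Num.min 1 (Num.max 0 t).

Section Clamp.
Variable R : realType.

Lemma clamp_ge0 (t : R) : 0 <= clamp t.
Proof. by rewrite le_min ler01 le_max lexx. Qed.

Lemma clamp_le1 (t : R) : clamp t <= 1.
Proof. by rewrite ge_min lexx. Qed.

Lemma clamp_le0 (t : R) : t <= 0 -> clamp t = 0.
Proof. by move=> t0; rewrite /clamp max_l// min_r. Qed.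

Lemma clamp_ge1 (t : R) : 1 <= t -> clamp t = 1.
Proof. by move=> t1; rewrite /clamp min_l// le_max t1 orbT. Qed.

Lemma continuous_clamp (X : topologicalType) (f : X -> R) :
  continuous f -> continuous (fun x => clamp (f x)).
Proof.
move=> cf; apply: continuous_real_min; first exact: cst_continuous.
by apply: continuous_real_max => //; exact: cst_continuous.
Qed.

End Clamp.

(** The straight line between two maps stays in the realization as soon as the
    supports of the two images of a point form a chain together. *)
Section StraightLine.
Variables (R : realType) (X : topologicalType) (d : Order.disp_t) (T : finPOrderType d).
Variables f g : X -> realization_space R T.
Hypothesis fg_chain : forall x s t,
  coord (f x) s != 0 -> coord (g x) t != 0 -> (s >=< t)%O.

Definition line_coord (p : X * R) : {ptws T -> R} := fun t =>
  (1 - clamp p.2) * coord (f p.1) t + clamp p.2 * coord (g p.1) t.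

Lemma line_coord_neq0 p t :
  line_coord p t != 0 -> coord (f p.1) t != 0 \/ coord (g p.1) t != 0.
Proof.
rewrite /line_coord; case: (eqVneq (coord (f p.1) t) 0) => [->|]; last by left.
by case: (eqVneq (coord (g p.1) t) 0) => [->|]; [rewrite !mulr0 addr0 eqxx | right].
Qed.

Lemma line_realization p : realization (line_coord p).
Proof.
split.
- move=> t; apply: addr_ge0; apply: mulr_ge0; rewrite ?clamp_ge0 ?coord_ge0//.
  by rewrite subr_ge0 clamp_le1.
- by rewrite big_split/= -!mulr_sumr !sum_coord !mulr1 subrK.
- move=> s t /line_coord_neq0[fs|gs] /line_coord_neq0[ft|gt].
  + exact: coord_chain fs ft.
  + exact: fg_chain fs gt.
  + by rewrite comparable_sym; exact: fg_chain ft gs.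
  + exact: coord_chain gs gt.
Qed.

Definition line_map p : realization_space R T := point_of (line_realization p).

Lemma line_map_neq0 p t : coord (line_map p) t != 0 ->
  coord (f p.1) t != 0 \/ coord (g p.1) t != 0.
Proof. exact: line_coord_neq0. Qed.

Lemma line_map0 x : line_map (x, 0) = f x.
Proof.
apply: coord_inj => t; rewrite coord_point_of /line_coord/= clamp_le0//.
by rewrite subr0 mul1r mul0r addr0.
Qed.

Lemma line_map1 x : line_map (x, 1) = g x.
Proof.
apply: coord_inj => t; rewrite coord_point_of /line_coord/= clamp_ge1//.
by rewrite subrr mul0r mul1r add0r.
Qed.

Lemma continuous_line : continuous f -> continuous g -> continuous line_map.
Proof.
move=> cf cg; apply: continuous_to_realization => t.
have cc : continuous (fun p : X * R => clamp p.2).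
  by apply: continuous_clamp; exact: continuous_snd.
have cl (h : X -> realization_space R T) : continuous h ->
    continuous (fun p : X * R => coord (h p.1) t).
  move=> ch; apply: (continuous_compose (@continuous_coord _ _ _ t)).
  by apply: (continuous_compose ch); exact: continuous_fst.
apply: continuous_realD; apply: continuous_realM => //; try exact: cl.
by apply: continuous_realB => //; exact: cst_continuous.
Qed.

End StraightLine.

Section MonotoneMap.
Variables (R : realType) (d d' : Order.disp_t).
Variables (T : finPOrderType d) (T' : finPOrderType d').

Section Def.
Variable f : T -> T'.
Hypothesis f_homo : {homo f : s t / (s <= t)%O}.

Lemma homo_coord_chain (x : realization_space R T) s t :
  coord x s != 0 -> coord x t != 0 -> (f s >=< f t)%O.
Proof.
move=> xs xt; rewrite /Order.comparable.
by case/orP: (coord_chain xs xt) => /f_homo ->; rewrite ?orbT.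
Qed.

Definition monotone_map : realization_space R T -> realization_space R T' :=
  weighted_map (w := fun t x => coord x t) (l := f)
    (fun t x => coord_ge0 x t) (@coord_neq0_ex R _ T) homo_coord_chain.

Lemma continuous_monotone : continuous monotone_map.
Proof. by apply: continuous_weighted => t; exact: continuous_coord. Qed.

Lemma monotone_map_neq0 x t :
  coord (monotone_map x) t != 0 -> exists2 s, f s = t & coord x s != 0.
Proof. exact: weighted_map_neq0. Qed.

Lemma coord_monotone x t :
  coord (monotone_map x) t = \sum_(s | f s == t) coord x s.
Proof. by rewrite coord_weighted /weighted_coord sum_coord divr1. Qed.

End Def.

(** Two monotone maps with f <= g have homotopic realizations. While the time
    runs from 0 to 1, mass is moved from f t to g t, starting with the largest
    elements t of the chain supporting x: the masses already moved then sit
    above those still to be moved, so that the images form a chain. *)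
Section Prism.
Variables f g : T -> T'.
Hypothesis f_homo : {homo f : s t / (s <= t)%O}.
Hypothesis g_homo : {homo g : s t / (s <= t)%O}.
Hypothesis fg : forall t, (f t <= g t)%O.
Local Notation P := (realization_space R T).

Definition mass_above (x : P) t := \sum_(s | (t < s)%O) coord x s.

Definition moved (t : T) (p : P * R) :=
  Num.min (coord p.1 t) (Num.max 0 (clamp p.2 - mass_above p.1 t)).

Definition prism_weight (i : T * bool) (p : P * R) :=
  if i.2 then moved i.1 p else coord p.1 i.1 - moved i.1 p.

Definition prism_label (i : T * bool) := if i.2 then g i.1 else f i.1.

Lemma moved_ge0 t p : 0 <= moved t p.
Proof. by rewrite le_min coord_ge0 le_max lexx. Qed.

Lemma moved_le t p : moved t p <= coord p.1 t.
Proof. by rewrite ge_min lexx. Qed.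

Lemma prism_weight_ge0 i p : 0 <= prism_weight i p.
Proof.
by case: i => t [] /=; rewrite /prism_weight/= ?moved_ge0// subr_ge0 moved_le.
Qed.

Lemma sum_prism_weight (Q : pred T) p :
  \sum_(i | Q i.1) prism_weight i p = \sum_(t | Q t) coord p.1 t.
Proof.
transitivity (\sum_(t | Q t) \sum_(b : bool) prism_weight (t, b) p).
  rewrite pair_big_dep /=; apply: eq_big => [[t b]|[t b] _] //=.
  by rewrite andbT.
by apply: eq_bigr => t _; rewrite big_bool /prism_weight /= addrC subrK.
Qed.

Lemma prism_weight_neq0 p : exists i, prism_weight i p != 0.
Proof.
apply/existsP; apply: contraTT isT; rewrite negb_exists => /forallP w0.
have := sum_prism_weight predT p; rewrite sum_coord big1 => [/eqP|i _].
  by rewrite eq_sym oner_eq0.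
by apply/eqP; rewrite -[_ == _]negbK w0.
Qed.

Lemma prism_weight_coord i p : prism_weight i p != 0 -> coord p.1 i.1 != 0.
Proof.
apply: contraNN => /eqP x0.
have m0 : moved i.1 p = 0.
  by apply/eqP; rewrite eq_le moved_ge0 -[X in _ <= X]x0 moved_le.
by rewrite /prism_weight m0 x0 subrr if_same.
Qed.

Lemma mass_above_lt x s t :
  (s < t)%O -> coord x t + mass_above x t <= mass_above x s.
Proof.
move=> st; rewrite /mass_above [leRHS](bigD1 t)//= lerD2l.
rewrite [leRHS](bigID (fun u => (t < u)%O))/=.
rewrite [X in _ <= X + _](_ : _ = \sum_(u | (t < u)%O) coord x u); last first.
  apply: eq_bigl => u; case: (boolP (t < u)%O) => [tu|]; last by rewrite andbF.
  by rewrite (lt_trans st tu) gt_eqF.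
by rewrite lerDl sumr_ge0// => u _; exact: coord_ge0.
Qed.

Lemma moved_neq0 t p : moved t p != 0 -> mass_above p.1 t < clamp p.2.
Proof.
apply: contraNT; rewrite -leNgt => h; rewrite /moved max_l ?subr_le0//.
by rewrite min_r ?coord_ge0.
Qed.

Lemma not_moved_neq0 t p :
  coord p.1 t - moved t p != 0 -> clamp p.2 < coord p.1 t + mass_above p.1 t.
Proof.
apply: contraNT; rewrite -leNgt -lerBrDr => h.
by rewrite /moved min_l ?subrr// le_max h orbT.
Qed.

Lemma prism_chain_aux s t p :
  coord p.1 s - moved s p != 0 -> moved t p != 0 -> (f s >=< g t)%O.
Proof.
move=> ns mt; have [/orP[st|]] : (s >=< t)%O /\ True.
- split=> //; apply: (@coord_chain _ _ _ p.1).
    exact: (@prism_weight_coord (s, false)).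
  exact: (@prism_weight_coord (t, true)).
- by rewrite /Order.comparable (le_trans (f_homo st) (fg t)).
- rewrite le_eqVlt => /predU1P[->|ts]; first by rewrite /Order.comparable fg.
  have := lt_le_trans (not_moved_neq0 ns) (mass_above_lt p.1 ts).
  by move/lt_trans => /(_ _ (moved_neq0 mt)); rewrite ltxx.
Qed.

Lemma prism_chain p i j : prism_weight i p != 0 -> prism_weight j p != 0 ->
  (prism_label i >=< prism_label j)%O.
Proof.
case: i j => [s b] [t b'] ws wt.
have xs : coord p.1 s != 0 := prism_weight_coord ws.
have xt : coord p.1 t != 0 := prism_weight_coord wt.
move: b b' ws wt => [] [] ws wt; rewrite /prism_label/=.
- exact: homo_coord_chain xs xt.
- by rewrite comparable_sym; exact: prism_chain_aux wt ws.
- exact: prism_chain_aux ws wt.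
- exact: homo_coord_chain xs xt.
Qed.

Definition prism : P * R -> realization_space R T' :=
  weighted_map prism_weight_ge0 prism_weight_neq0 prism_chain.

Lemma continuous_prism : continuous prism.
Proof.
have cx t : continuous (fun p : P * R => coord p.1 t).
  apply: (continuous_compose (@continuous_coord _ _ _ t)).
  exact: continuous_fst.
have cm t : continuous (moved t).
  apply: continuous_real_min => //; apply: continuous_real_max.
    exact: cst_continuous.
  apply: continuous_realB; last by apply: continuous_real_sum => s; exact: cx.
  by apply: continuous_clamp; exact: continuous_snd.
apply: continuous_weighted => -[t []]; first exact: cm.
by apply: continuous_realB; [exact: cx | exact: cm].
Qed.

Lemma prism_neq0 p t : coord (prism p) t != 0 ->
  exists s, coord p.1 s != 0 /\ (t = f s \/ t = g s).
Proof.
move/weighted_map_neq0 => [[s b] <- /prism_weight_coord/= xs].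
by exists s; split=> //; case: (b); [right | left].
Qed.

Lemma prism_end (h : T -> T') (b : bool) x tau :
  (forall t, prism_label (t, b) = h t) ->
  (forall t, prism_weight (t, ~~ b) (x, tau) = 0) ->
  forall t, coord (prism (x, tau)) t = \sum_(s | h s == t) coord x s.
Proof.
move=> lh w0 t; rewrite coord_weighted /weighted_coord.
rewrite (@sum_prism_weight predT) sum_coord divr1.
transitivity (\sum_(i | h i.1 == t) prism_weight i (x, tau)); last first.
  exact: (@sum_prism_weight (fun s => h s == t)).
rewrite [LHS]big_mkcond [RHS]big_mkcond; apply: eq_bigr => -[s b'] _ /=.
have [->|nb] := eqVneq b' b; first by rewrite lh.
suff -> : b' = ~~ b by rewrite w0 !if_same.
by case: (b') (b) nb => [] [].
Qed.

Lemma prism0 x : prism (x, 0) = monotone_map f_homo x.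
Proof.
apply: coord_inj => t; rewrite coord_monotone.
apply: (@prism_end f false) => // s; rewrite /prism_weight/= /moved/= clamp_le0//.
by rewrite max_l ?min_r ?coord_ge0// sub0r oppr_le0 sumr_ge0// => u _; exact: coord_ge0.
Qed.

Lemma prism1 x : prism (x, 1) = monotone_map g_homo x.
Proof.
apply: coord_inj => t; rewrite coord_monotone.
apply: (@prism_end g true) => // s; rewrite /prism_weight/= /moved/= clamp_ge1//.
rewrite min_l ?subrr// le_max; apply/orP; right.
rewrite lerBrDr -[leRHS](sum_coord x) [leRHS](bigD1 s)//= lerD2l /mass_above [leLHS]big_mkcond [leRHS]big_mkcond/=.
apply: ler_sum => u _; case: ifPn => [su|_]; first by rewrite gt_eqF.
by case: ifP; rewrite ?coord_ge0.
Qed.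

End Prism.
End MonotoneMap.

Arguments monotone_map R {d d' T T' f} f_homo x.

(** * Maps compatible with the isotropy groups *)

(** The isotropy group over a point of the realization of T is the one of the
    smallest element of its support, and it is governed by a set of labels c t
    attached to each element t. A map f can be extended by the identity of the
    torus if isotropy does not decrease, which is the case when every element
    supporting f x carries all labels of some element supporting x. Homotopies
    are maps from the product with R, whence the projection pr to the space
    whose labels are compared. *)
Section Labels.
Variables (R : realType) (U : finType).

Definition keeps_labels d (T : finPOrderType d) d' (T' : finPOrderType d')
    (c : T -> {set U}) (c' : T' -> {set U}) (X : Type)
    (pr : X -> realization_space R T) (f : X -> realization_space R T') :=
  forall x t', coord (f x) t' != 0 ->
    exists2 t, coord (pr x) t != 0 & c t \subset c' t'.

Section Homotopy.
Variables (d d' : Order.disp_t) (T : finPOrderType d) (T' : finPOrderType d').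
Variables (c : T -> {set U}) (c' : T' -> {set U}).
Local Notation P := (realization_space R T).
Local Notation P' := (realization_space R T').

Definition label_homotopic (f g : P -> P') :=
  exists h : P * R -> P',
    [/\ continuous h, keeps_labels c c' fst h,
        forall x, h (x, 0) = f x & forall x, h (x, 1) = g x].

Lemma label_homotopic_sym f g : label_homotopic f g -> label_homotopic g f.
Proof.
move=> [h [ch lh h0 h1]]; exists (fun p => h (p.1, 1 - p.2)); split.
- apply: (continuous_compose ch); apply: continuous_pair; first exact: continuous_fst.
  by apply: continuous_realB; [exact: cst_continuous | exact: continuous_snd].
- by move=> [x t] t'; exact: lh.
- by move=> x /=; rewrite subr0.
- by move=> x /=; rewrite subrr.
Qed.

(** The time of each homotopy is clamped, so that at any moment at least one of
    the two is at rest in g x; hence h1 + h2 - g takes the values of the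
    concatenation and its continuity needs no gluing. *)
Lemma label_homotopic_trans f g k :
  label_homotopic f g -> label_homotopic g k -> label_homotopic f k.
Proof.
move=> [h1 [ch1 lh1 h10 h11]] [h2 [ch2 lh2 h20 h21]].
pose a1 (p : P * R) := h1 (p.1, clamp (2 * p.2)).
pose a2 (p : P * R) := h2 (p.1, clamp (2 * p.2 - 1)).
pose h p := if p.2 <= 1 / 2 then a1 p else a2 p.
have hE p t : coord (h p) t = coord (a1 p) t + coord (a2 p) t - coord (g p.1) t.
  rewrite /h; case: ifPn => [pt|]; rewrite /a1 /a2.
    by rewrite [clamp (_ - 1)]clamp_le0 ?h20 ?addrK//; lra.
  rewrite -ltNge => pt; rewrite [clamp (2 * p.2)]clamp_ge1 ?h11; last by lra.
  by rewrite addrAC subrr add0r.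
have c2 : continuous (fun p : P * R => 2 * p.2).
  by apply: continuous_realM; [exact: cst_continuous | exact: continuous_snd].
have cc t : continuous (fun x : P' => coord x t) by exact: continuous_coord.
exists h; split.
- apply: continuous_to_realization => t.
  rewrite [X in continuous X](_ : _ = fun p =>
    coord (a1 p) t + coord (a2 p) t - coord (g p.1) t); last exact/funext.
  apply: continuous_realB; first apply: continuous_realD.
  + apply: (continuous_compose (cc t)); apply: (continuous_compose ch1).
    by apply: continuous_pair; [exact: continuous_fst | exact: continuous_clamp].
  + apply: (continuous_compose (cc t)); apply: (continuous_compose ch2).
    apply: continuous_pair; first exact: continuous_fst.
    apply: continuous_clamp; apply: continuous_realB => //.
    exact: cst_continuous.
  + apply: (continuous_compose (cc t)).
    rewrite [X in continuous X](_ : _ = fun p => h2 (p.1, 0)); last first.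
      by apply/funext => p; rewrite h20.
    apply: (continuous_compose ch2); apply: continuous_pair.
      exact: continuous_fst.
    exact: cst_continuous.
- by move=> p t'; rewrite /h; case: ifP => _; [exact: lh1 | exact: lh2].
- by move=> x; rewrite /h /a1 /= mulr0 clamp_le0// ifT ?h10//; lra.
- move=> x; rewrite /h /a2 /= ifF; last by apply/negbTE; rewrite -ltNge; lra.
  by rewrite clamp_ge1 ?h21//; lra.
Qed.

Lemma label_homotopic_line (f g : P -> P') :
  continuous f -> continuous g ->
  keeps_labels c c' id f -> keeps_labels c c' id g ->
  (forall x s t, coord (f x) s != 0 -> coord (g x) t != 0 -> (s >=< t)%O) ->
  label_homotopic f g.
Proof.
move=> cf cg lf lg fg; exists (line_map fg); split.
- exact: continuous_line.
- by move=> p t' /line_map_neq0[]; [exact: lf | exact: lg].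
- exact: line_map0.
- exact: line_map1.
Qed.

Lemma label_homotopic_monotone (f g : T -> T')
    (f_homo : {homo f : s t / (s <= t)%O}) (g_homo : {homo g : s t / (s <= t)%O}) :
  (forall t, (f t <= g t)%O) ->
  (forall t, c t \subset c' (f t)) -> (forall t, c t \subset c' (g t)) ->
  label_homotopic (monotone_map R f_homo) (monotone_map R g_homo).
Proof.
move=> fg cf cg; exists (prism f_homo g_homo fg); split.
- exact: continuous_prism.
- by move=> p t' /prism_neq0[s [ps [->|->]]]; exists s.
- exact: prism0.
- exact: prism1.
Qed.

End Homotopy.
End Labels.

(** * Homomorphisms of tori given by integer matrices *)

Section TorusMap.
Variable R : realType.
Local Notation C := (Cplx R).

(** The homomorphism of tori that is m |-> m *m M on cocharacters. *)
Definition tpow k l (M : 'M[int]_(k, l)) (g : 'rV[C]_k) : 'rV[C]_l :=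
  \row_j \prod_i g 0 i ^ M i j.

Lemma torus_neq0 k (g : 'rV[C]_k) i : torus g -> g 0 i != 0.
Proof. by move=> gT; rewrite -normr_gt0 gT ltr01. Qed.

(** The nonvanishing of the partial products is carried along, because negative powers
    are multiplicative only on units. *)
Lemma exprz_prod (I : finType) (f : I -> C) (n : int) :
  (forall i, f i != 0) -> (\prod_i f i) ^ n = \prod_i f i ^ n.
Proof.
move=> f0; pose K (x y : C) := x != 0 /\ x ^ n = y.
suff [] : K (\prod_i f i) (\prod_i f i ^ n) by [].
elim/big_rec2: _ => [|i y x _ [x0 xy]]; split=> //.
- exact: oner_neq0.
- by rewrite exp1rz.
- by rewrite mulf_neq0.
- by rewrite exprzMl ?unitfE// xy.
Qed.

Lemma exprz_sum (I : finType) (z : C) (f : I -> int) :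
  z != 0 -> z ^ (\sum_i f i) = \prod_i z ^ f i.
Proof.
move=> z0; apply: (big_morph (fun n => z ^ n)) => [m n|]; last exact: expr0z.
exact: expfzDr.
Qed.

Lemma tpow_torus k l (M : 'M[int]_(k, l)) g : torus g -> torus (tpow M g).
Proof.
move=> gT j; rewrite mxE normr_prod big1// => i _.
by have := cocharacter_torus (const_mx (M i j)) (gT i) j; rewrite !mxE.
Qed.

Lemma tpow_tdiv k l (M : 'M[int]_(k, l)) g h : torus g -> torus h ->
  tpow M (tdiv g h) = tdiv (tpow M g) (tpow M h).
Proof.
move=> gT hT; apply/rowP => j; rewrite !mxE -prodf_div; apply: eq_bigr => i _.
have g0 := torus_neq0 i gT; have h0 := torus_neq0 i hT.
by rewrite mxE exprzMl ?unitfE ?invr_eq0// exprz_inv invr_expz.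
Qed.

Lemma tpow_tone k l (M : 'M[int]_(k, l)) : tpow M (tone R k) = tone R l.
Proof. by apply/rowP => j; rewrite !mxE big1// => i _; rewrite mxE exp1rz. Qed.

Lemma tpow_cocharacter k l (M : 'M[int]_(k, l)) m (z : C) : z != 0 ->
  tpow M (cocharacter m z) = cocharacter (m *m M) z.
Proof.
move=> z0; apply/rowP => j; rewrite !mxE exprz_sum//.
by apply: eq_bigr => i _; rewrite mxE exprz_exp.
Qed.

Lemma tpow_mul k l n (M : 'M[int]_(k, l)) (N : 'M[int]_(l, n)) g : torus g ->
  tpow N (tpow M g) = tpow (M *m N) g.
Proof.
move=> gT; have g0 i := torus_neq0 i gT; apply/rowP => j; rewrite !mxE.
transitivity (\prod_i \prod_s g 0 s ^ (M s i * N i j)).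
  apply: eq_bigr => i _; rewrite mxE exprz_prod.
    by apply: eq_bigr => s _; rewrite exprz_exp.
  by move=> s; rewrite expfz_neq0.
by rewrite exchange_big; apply: eq_bigr => i _; rewrite mxE exprz_sum.
Qed.

Lemma tpow1 k (g : 'rV[C]_k) : tpow 1%:M g = g.
Proof.
apply/rowP => j; rewrite mxE (bigD1 j)//= big1 => [|i ij].
  by rewrite mxE eqxx expr1z mulr1.
by rewrite mxE (negbTE ij) expr0z.
Qed.

(** The preimage of a subgroup under a homomorphism is a subgroup, both for tori and
    for the lattices of cocharacters; hence it is enough to compare generators. *)
Lemma isotropy_tpow k l (V W : finType) (la : V -> 'rV[int]_k)
    (lb : W -> 'rV[int]_l) (M : 'M[int]_(k, l)) (A : {set V}) (B : {set W}) g :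
  (forall v, v \in A -> exists2 w, w \in B & la v *m M = lb w) ->
  isotropy R la A g -> isotropy R lb B (tpow M g).
Proof.
move=> AB gA H [[HT H1 Hd] BH].
suff [] : torus g /\ H (tpow M g) by [].
apply: (gA (fun g => torus g /\ H (tpow M g))); split; first split.
- by move=> ? [].
- by rewrite tpow_tone; split=> //; case: (@torus_tsubgroup R k).
- move=> a b [aT Ha] [bT Hb]; rewrite tpow_tdiv//; split; last exact: Hd.
  by case: (@torus_tsubgroup R k) => _ _; exact.
move=> _ [m Am [z z1 ->]]; split; first exact: cocharacter_torus.
rewrite tpow_cocharacter; last by rewrite -normr_gt0 z1 ltr01.
apply: BH; exists (m *m M); last by exists z.
move=> K [[K0 Ks] BK]; apply: (Am (fun m => K (m *m M))); split; first split.
- by rewrite mul0mx.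
- by move=> x y Kx Ky; rewrite mulmxBl; exact: Ks.
- move=> _ [v vA <-]; have [w wB ->] := AB v vA.
  by apply: BK; exists w.
Qed.

Definition torus_map k l (M : 'M[int]_(k, l)) (g : set_type (@torus R k)) :
    set_type (@torus R l) :=
  exist _ (tpow M (set_val g)) (mem_set (tpow_torus M (set_valP g))).

Lemma torus_mapK k l (M : 'M[int]_(k, l)) (N : 'M[int]_(l, k)) :
  M *m N = 1%:M -> cancel (torus_map M) (torus_map N).
Proof.
move=> MN g; apply: val_inj; rewrite /= tpow_mul ?MN ?tpow1//.
exact: set_valP.
Qed.

Lemma continuous_exprz (X : topologicalType) (f : X -> C) (n : int) :
  (forall x, f x != 0) -> continuous f -> continuous (fun x => f x ^ n).
Proof.
move=> f0 cf; have cn (m : nat) : continuous (fun x => f x ^+ m).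
  rewrite [Y in continuous Y](_ : _ = fun x => \prod_(i < m) f x); last first.
    by apply/funext => x; rewrite prodr_const card_ord.
  by apply: continuous_big => //; exact: mul_continuous.
case: n => m; first exact: cn.
suff : continuous (fun x => (f x ^+ m.+1)^-1) by [].
by move=> x; apply: cvgV; [rewrite expf_neq0 | exact: cn].
Qed.

Lemma continuous_torus_map k l (M : 'M[int]_(k, l)) : continuous (torus_map M).
Proof.
apply: continuous_set_type; apply: continuous_mx => i j.
rewrite [X in continuous X](_ : _ = fun g : set_type (@torus R k) =>
    \prod_s set_val g 0 s ^ M s j); last by apply/funext => g; rewrite mxE.
apply: continuous_big => [|s _]; first exact: mul_continuous.
apply: continuous_exprz => [g|]; first by apply: torus_neq0; exact: set_valP.
apply: (continuous_compose (@coord_continuous _ _ _ _ _)).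
exact: continuous_set_val.
Qed.

End TorusMap.

(** * Maps and homotopies of identification spaces *)

Section QuotientTimesR.
Import ArrowAsCompactOpen.
Local Open Scope quotient_scope.
Variables (R : realType) (X Y : topologicalType) (Q0 : quotType X).
Local Notation Q := (quotient_topology Q0).

(** As R is locally compact, maps out of Q * R are the same as maps from Q to the
    space of paths with the compact-open topology, and continuity of the latter
    can be tested on X. *)
Lemma continuous_quotient_times (F : X * R -> Y) :
  continuous F ->
  (forall a b t, \pi_Q a = \pi_Q b -> F (a, t) = F (b, t)) ->
  continuous (fun p : Q * R => F (repr p.1, p.2)).
Proof.
move=> cF FE; pose G (q : Q) : R -> Y := curry F (repr q).
have GE a : G (\pi_Q a) = curry F a.
  by apply/funext => t; apply: FE; rewrite reprK.
have [cc cF1] := continuous_curry cF.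
have cG : continuous (G : Q -> R -> Y).
  apply/quotient_continuous; rewrite (_ : G \o _ = curry F)//.
  by apply/funext => a; exact: GE.
have := continuous_uncurry (@locally_compactR R) (@Rhausdorff R) cG.
rewrite (_ : uncurry G = fun p : Q * R => F (repr p.1, p.2)); last first.
  by apply/funext => -[].
by apply=> q; exact: cF1.
Qed.

End QuotientTimesR.

Section Quotient.
Local Open Scope quotient_scope.
Variables (R : realType) (d : Order.disp_t) (T : finPOrderType d) (k : nat).
Variable G : T -> set 'rV[Cplx R]_k.
Hypothesis G_subgroup : forall s, tsubgroup (G s).
Hypothesis G_mono : forall s t, (s <= t)%O -> G s `<=` G t.
Local Notation Z := (identification_space G_subgroup G_mono).

Definition to_quotient (a : prespace R T k) : Z :=
  \pi_(quotient_topology {eq_quot glue_equiv G_subgroup G_mono}) a.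

Definition of_quotient (q : Z) : prespace R T k :=
  repr (q : quotient_topology {eq_quot glue_equiv G_subgroup G_mono}).

Lemma of_quotientK : cancel of_quotient to_quotient.
Proof. by move=> q; exact: reprK. Qed.

Lemma to_quotientP a b : reflect (to_quotient a = to_quotient b) (torus_glue G a b).
Proof. exact: eqmodP. Qed.

Lemma continuous_to_quotient : continuous to_quotient.
Proof. exact: pi_continuous. Qed.

Lemma continuous_of_quotient (Y : topologicalType) (F : prespace R T k -> Y) :
  continuous F -> (forall a b, torus_glue G a b -> F a = F b) ->
  continuous (fun q => F (of_quotient q)).
Proof.
move=> cF FE; apply: (@repr_comp_continuous _ _ _ F cF) => a b /eqP ab.
by apply/eqP/FE/to_quotientP.
Qed.

Lemma continuous_of_quotient_times (Y : topologicalType)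
    (F : prespace R T k * R -> Y) :
  continuous F ->
  (forall a b t, torus_glue G a b -> F (a, t) = F (b, t)) ->
  continuous (fun p : Z * R => F (of_quotient p.1, p.2)).
Proof.
move=> cF FE; apply: continuous_quotient_times => // a b t ab.
by apply: FE; apply/to_quotientP.
Qed.

End Quotient.

Definition tpow_compatible (R : realType) (U : finType) (T T' : Type) k l
    (c : T -> {set U}) (c' : T' -> {set U})
    (G : T -> set 'rV[Cplx R]_k) (G' : T' -> set 'rV[Cplx R]_l)
    (M : 'M[int]_(k, l)) :=
  forall s t g, c s \subset c' t -> G s g -> G' t (tpow M g).

Section IdentificationMaps.
Variables (R : realType) (U : finType).
Variables (d d' : Order.disp_t) (T : finPOrderType d) (T' : finPOrderType d').
Variables (k l : nat) (c : T -> {set U}) (c' : T' -> {set U}).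
Variables (G : T -> set 'rV[Cplx R]_k) (G' : T' -> set 'rV[Cplx R]_l).
Hypothesis c_mono : forall s t, (s <= t)%O -> c s \subset c t.
Hypothesis G_subgroup : forall s, tsubgroup (G s).
Hypothesis G_mono : forall s t, (s <= t)%O -> G s `<=` G t.
Hypothesis G'_subgroup : forall s, tsubgroup (G' s).
Hypothesis G'_mono : forall s t, (s <= t)%O -> G' s `<=` G' t.
Local Notation P := (realization_space R T).
Local Notation P' := (realization_space R T').
Local Notation Z := (identification_space G_subgroup G_mono).
Local Notation Z' := (identification_space G'_subgroup G'_mono).
Variable M : 'M[int]_(k, l).
Hypothesis GM : tpow_compatible c c' G G' M.

(** If a.1 lies in the dual face of s, then some element supporting a.1, and lying
    above s, has its labels among those of the smallest element m supporting y. So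
    the isotropy at s is carried into the isotropy at m. *)
Lemma glue_image (a b : prespace R T k) (y : P') :
  (forall t', coord y t' != 0 -> exists2 t, coord a.1 t != 0 & c t \subset c' t') ->
  torus_glue G a b ->
  torus_glue G' ((y, torus_map M a.2) : prespace R T' l) (y, torus_map M b.2).
Proof.
move=> ay /asboolP[_ [s [[_ sa] Gs]]]; apply/asboolP; split=> //=.
have [m ym mmin] := coord_min y; exists m; split.
  by split=> //; exact: set_valP.
have [t xt ct] := ay m ym; rewrite -tpow_tdiv; try exact: set_valP.
apply: GM Gs; apply: fintype.subset_trans ct; apply: c_mono; exact: sa.
Qed.

Definition prespace_map (f : P -> P') (a : prespace R T k) : prespace R T' l :=
  (f a.1, torus_map M a.2).

Definition induced (f : P -> P') (q : Z) : Z' :=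
  to_quotient G'_subgroup G'_mono (prespace_map f (of_quotient q)).

Lemma glue_prespace_map f a b : keeps_labels c c' id f ->
  torus_glue G a b -> torus_glue G' (prespace_map f a) (prespace_map f b).
Proof.
move=> lf ab; have := glue_image (lf a.1) ab.
by case/asboolP: ab => ab _; rewrite /prespace_map ab.
Qed.

Lemma induced_to_quotient f a : keeps_labels c c' id f ->
  induced f (to_quotient G_subgroup G_mono a) =
  to_quotient G'_subgroup G'_mono (prespace_map f a).
Proof.
move=> lf; apply/to_quotientP/glue_prespace_map => //.
by apply/(to_quotientP G_subgroup G_mono); rewrite of_quotientK.
Qed.

Lemma continuous_induced f : continuous f -> keeps_labels c c' id f ->
  continuous (induced f).
Proof.
move=> cf lf; rewrite /induced.
apply: (@continuous_of_quotient _ _ _ _ _ _ _ _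
  (fun a => to_quotient G'_subgroup G'_mono (prespace_map f a))).
- apply: (continuous_compose (@continuous_to_quotient _ _ _ _ _ _ _)).
  apply: (@continuous_pair _ P' (set_type (@torus R l))).
    by apply: (continuous_compose cf); exact: continuous_fst.
  apply: (continuous_compose (@continuous_torus_map _ _ _ M)).
  exact: continuous_snd.
- by move=> a b ab; apply/to_quotientP; exact: glue_prespace_map.
Qed.

End IdentificationMaps.

Section IdentificationHomotopy.
Variables (R : realType) (U : finType).
Variables (d : Order.disp_t) (T : finPOrderType d).
Variables (k : nat) (c : T -> {set U}) (G : T -> set 'rV[Cplx R]_k).
Hypothesis c_mono : forall s t, (s <= t)%O -> c s \subset c t.
Hypothesis G_subgroup : forall s, tsubgroup (G s).
Hypothesis G_mono : forall s t, (s <= t)%O -> G s `<=` G t.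
Hypothesis G_labels : forall s t, c s \subset c t -> G s `<=` G t.
Local Notation P := (realization_space R T).
Local Notation Z := (identification_space G_subgroup G_mono).

(** The torus coordinate is kept at all times, which is the case of the identity
    matrix in glue_image. *)
Lemma homotopic_id (f : P -> P) (F : Z -> Z) :
  label_homotopic c c f id ->
  (forall q, F q = to_quotient G_subgroup G_mono
                     (f (of_quotient q).1, (of_quotient q).2)) ->
  homotopic R F id.
Proof.
move=> [h [ch lh h0 h1]] FE.
pose H (p : prespace R T k * R) :=
  to_quotient G_subgroup G_mono (h (p.1.1, p.2), p.1.2).
have compat1 : tpow_compatible c c G G 1%:M.
  by move=> s t g st Gs; rewrite tpow1; exact: G_labels Gs.
have cH : continuous H.
  apply: (continuous_compose (@continuous_to_quotient _ _ _ _ _ _ _)).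
  have c1 : continuous (fun p : prespace R T k * R => p.1).
    exact: (@continuous_fst (prespace R T k) R).
  apply: (@continuous_pair _ P (set_type (@torus R k))).
    apply: (continuous_compose ch); apply: (@continuous_pair _ P R).
      by apply: (continuous_compose _ c1); exact: continuous_fst.
    exact: (@continuous_snd (prespace R T k) R).
  by apply: (continuous_compose _ c1); exact: continuous_snd.
exists (fun p => H (of_quotient p.1, p.2)); split.
- apply: continuous_subspaceT; apply: continuous_of_quotient_times => //.
  move=> a b t ab; apply/to_quotientP.
  have := glue_image c_mono compat1 (lh (a.1, t)) ab.
  have t1 g : torus_map 1%:M g = g :> set_type (@torus R k).
    by apply: val_inj; rewrite /= tpow1.
  by case/asboolP: ab => ab _; rewrite !t1 -ab.
- by move=> q; rewrite /H /= h0 FE.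
- by move=> q; rewrite /H /= h1 -surjective_pairing of_quotientK.
Qed.

End IdentificationHomotopy.

(** The maps act separately on the two coordinates, and the torus coordinate returns to
    itself because M and N are inverse to each other; so only the coordinate in the
    realization has to be deformed. *)
Section IdentificationEquivalence.
Variables (R : realType) (U : finType).
Variables (d d' : Order.disp_t) (T : finPOrderType d) (T' : finPOrderType d').
Variables (k l : nat) (c : T -> {set U}) (c' : T' -> {set U}).
Variables (G : T -> set 'rV[Cplx R]_k) (G' : T' -> set 'rV[Cplx R]_l).
Hypothesis c_mono : forall s t, (s <= t)%O -> c s \subset c t.
Hypothesis c'_mono : forall s t, (s <= t)%O -> c' s \subset c' t.
Hypothesis G_subgroup : forall s, tsubgroup (G s).
Hypothesis G_mono : forall s t, (s <= t)%O -> G s `<=` G t.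
Hypothesis G_labels : forall s t, c s \subset c t -> G s `<=` G t.
Hypothesis G'_subgroup : forall s, tsubgroup (G' s).
Hypothesis G'_mono : forall s t, (s <= t)%O -> G' s `<=` G' t.
Hypothesis G'_labels : forall s t, c' s \subset c' t -> G' s `<=` G' t.

Lemma identification_equivalence (M : 'M[int]_(k, l)) (N : 'M[int]_(l, k))
    (f : realization_space R T -> realization_space R T')
    (g : realization_space R T' -> realization_space R T) :
  M *m N = 1%:M -> N *m M = 1%:M ->
  tpow_compatible c c' G G' M -> tpow_compatible c' c G' G N ->
  continuous f -> continuous g ->
  keeps_labels c c' id f -> keeps_labels c' c id g ->
  label_homotopic c c (g \o f) id -> label_homotopic c' c' (f \o g) id ->
  homotopy_equivalent R (identification_space G_subgroup G_mono)
    (identification_space G'_subgroup G'_mono).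
Proof.
move=> MN NM GM GN cf cg lf lg gf fg.
pose F := @induced R d d' T T' k l G G' G_subgroup G_mono G'_subgroup G'_mono M f.
pose F' := @induced R d' d T' T l k G' G G'_subgroup G'_mono G_subgroup G_mono N g.
exists F, F'; split.
- exact: (continuous_induced c_mono GM).
- exact: (continuous_induced c'_mono GN).
- apply: (homotopic_id c_mono G_labels gf) => q.
  rewrite /= /F' (induced_to_quotient c'_mono _ _ _ _ GN)// /prespace_map/=.
  by rewrite torus_mapK.
- apply: (homotopic_id c'_mono G'_labels fg) => q.
  rewrite /= /F (induced_to_quotient c_mono _ _ _ _ GM)// /prespace_map/=.
  by rewrite torus_mapK.
Qed.

End IdentificationEquivalence.

(** * The complex of coloured flags *)

(** Points of a realization are turned into points of a realization with simplices
    as vertices by means of their superlevel sets: these are nested, and varying x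
    continuously makes them appear and disappear with weight zero. *)
Section Superlevel.
Variables (R : realType) (d : Order.disp_t) (T : finPOrderType d).
Local Notation P := (realization_space R T).
Implicit Types (x : P) (D : {set T}).

Definition superlevel x D :=
  [/\ D != finset.set0, forall t, t \in D -> coord x t != 0 &
      forall s t, s \in D -> t \notin D -> coord x t < coord x s].

Definition superlevel_weight D x : R :=
  if D == finset.set0 then 0 else
  \prod_(s in D) (coord x s *
    \prod_(t | t \notin D) Num.max 0 (coord x s - coord x t)).

Lemma superlevel_weight_ge0 D x : 0 <= superlevel_weight D x.
Proof.
rewrite /superlevel_weight; case: ifP => // _; apply: prodr_ge0 => s _.
by rewrite mulr_ge0 ?coord_ge0// prodr_ge0// => t _; rewrite le_max lexx.
Qed.

Lemma superlevel_weightP D x : reflect (superlevel x D) (superlevel_weight D x != 0).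
Proof.
rewrite /superlevel_weight; case: (eqVneq D) => [->|D0].
  by rewrite eqxx; constructor => -[]; rewrite eqxx.
apply: (iffP (prodf_neq0 _ _)) => [w0|[_ xD xDC] s sD].
  split=> // [t /w0|s t /w0 + tD]; rewrite mulf_eq0 negb_or => /andP[]//.
  move=> _ /prodf_neq0 /(_ t tD).
  by rewrite /Order.max; case: ifP; rewrite ?eqxx// subr_gt0.
rewrite mulf_neq0 ?xD//; apply/prodf_neq0 => t tD.
by rewrite gt_eqF// lt_max subr_gt0 xDC ?orbT.
Qed.

Lemma superlevel_ex x : exists D, superlevel_weight D x != 0.
Proof.
have [t0 xt0] := coord_neq0_ex x.
case: (@Order.TotalTheory.arg_maxP _ _ _ t0 predT (coord x) isT) => m _ mmax.
have {}mmax t : coord x t <= coord x m := mmax t isT.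
exists [set t | coord x t == coord x m]%SET; apply/superlevel_weightP; split.
- by apply/set0Pn; exists m; rewrite inE.
- move=> t; rewrite inE => /eqP ->; rewrite gt_eqF//.
  exact: lt_le_trans (coord_gt0 xt0) (mmax _).
- by move=> s t; rewrite !inE => /eqP -> tm; rewrite lt_neqAle tm mmax.
Qed.

Lemma superlevel_nested x D E :
  superlevel x D -> superlevel x E -> D \subset E \/ E \subset D.
Proof.
move=> [_ _ xD] [_ _ xE]; have [|] := boolP (D \subset E); first by left.
case/subsetPn => s sD sE; right; apply/fintype.subsetP => t tE.
by apply: contraT => tD; have := lt_trans (xD _ _ sD tD) (xE _ _ tE sE); rewrite ltxx.
Qed.

Lemma continuous_superlevel_weight D : continuous (superlevel_weight D).
Proof.
rewrite /superlevel_weight; case: (D == finset.set0); first exact: cst_continuous.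
apply: continuous_real_prod => s; apply: continuous_realM.
  exact: continuous_coord.
apply: continuous_real_prod => t; apply: continuous_real_max.
  exact: cst_continuous.
by apply: continuous_realB; exact: continuous_coord.
Qed.

End Superlevel.

Section FlagComplex.
Variables (d : Order.disp_t) (S : finBPOrderType d) (U : finType).
Variable c : S -> {set U}.
Hypothesis c_mono : forall s t, (s <= t)%O -> c s \subset c t.

(** Here c is any monotone labelling; for the theorem c s is the set of vertices
    below s. *)
Definition flag_vertex := {p : U * S | p.1 \in c p.2}.
HB.instance Definition _ := SubFinite.on flag_vertex.

Definition flag_color (p : flag_vertex) : U := (val p).1.
Definition flag_height (p : flag_vertex) : S := (val p).2.

Definition is_flag (A : {set flag_vertex}) :=
  [forall p in A, forall q in A, (flag_height p >=< flag_height q)%O].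

Lemma is_flagP (A : {set flag_vertex}) : reflect
  (forall p q, p \in A -> q \in A -> (flag_height p >=< flag_height q)%O) (is_flag A).
Proof.
apply: (iffP forall_inP) => [AP p q pA qA|AP p pA].
  by have /forall_inP := AP p pA; apply.
by apply/forall_inP => q qA; exact: AP.
Qed.

Definition flags := [set A : {set flag_vertex} | is_flag A]%SET.

Lemma flags_empty : finset.set0 \in flags.
Proof. by rewrite inE; apply/is_flagP => p q; rewrite inE. Qed.

Lemma flags_sub (A B : {set flag_vertex}) : A \subset B -> B \in flags -> A \in flags.
Proof.
move=> /fintype.subsetP AB; rewrite !inE => /is_flagP BP.
by apply/is_flagP => p q pA qA; apply: BP; exact: AB.
Qed.

Definition flag_complex := SimplicialComplex flags_empty flags_sub.
Local Notation K := (simplex flag_complex).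
Implicit Types (A B : K) (D : {set S}).

Lemma flag_leE A B : (A <= B)%O = (val A \subset val B).
Proof. by []. Qed.

Definition colors A : {set U} := (flag_color @: val A)%SET.

(** The element \bot belongs to the heights of all simplices, the empty one
    included. *)
Definition heights A : {set S} := (\bot |: [set flag_height p | p in val A])%O%SET.

Lemma colors_mono A B : (A <= B)%O -> colors A \subset colors B.
Proof. by rewrite flag_leE => AB; exact: imsetS. Qed.

Lemma heights_mono A B : (A <= B)%O -> heights A \subset heights B.
Proof. by rewrite flag_leE => AB; apply: finset.setUS; exact: imsetS. Qed.

Lemma bot_heights A : \bot%O \in heights A.
Proof. by rewrite !inE eqxx. Qed.

Lemma mem_heights A p : p \in val A -> flag_height p \in heights A.
Proof. by move=> pA; rewrite inE imset_f ?orbT. Qed.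

Lemma heights_chain A s t : s \in heights A -> t \in heights A -> (s >=< t)%O.
Proof.
have := valP A; rewrite /= inE => /is_flagP AP.
rewrite !inE /Order.comparable => /predU1P[->|/imsetP[p pA ->]]; first by rewrite le0x.
move=> /predU1P[->|/imsetP[q qA ->]]; first by rewrite le0x orbT.
exact: AP.
Qed.

Lemma top_height_ex A :
  exists s, (s \in heights A) && [forall t in heights A, (t <= s)%O].
Proof.
have [s [sA smax]] := chain_max (@heights_chain A) (bot_heights A).
by exists s; rewrite [_ \in _]sA; apply/forall_inP.
Qed.

Definition top_height A : S := xchoose (top_height_ex A).

Lemma top_height_mem A : top_height A \in heights A.
Proof. by case/andP: (xchooseP (top_height_ex A)). Qed.

Lemma top_height_max A s : s \in heights A -> (s <= top_height A)%O.
Proof. by move: s; case/andP: (xchooseP (top_height_ex A)) => _ /forall_inP. Qed.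

Lemma top_height_mono : {homo top_height : A B / (A <= B)%O}.
Proof.
move=> A B AB; apply: top_height_max; apply: fintype.subsetP (top_height_mem A).
exact: heights_mono.
Qed.

Lemma colors_top_height A : colors A \subset c (top_height A).
Proof.
apply/fintype.subsetP => _ /imsetP[p pA ->].
apply: fintype.subsetP (valP p); apply: c_mono.
by apply: top_height_max; exact: mem_heights.
Qed.

Definition full_block D : {set flag_vertex} := [set p | flag_height p \in D]%SET.

(** Meant for chains D; other sets are sent to the empty simplex. *)
Definition full_flag D : K :=
  insubd (Sub finset.set0 (empty_simplex flag_complex) : K) (full_block D).

Definition chain_set D := forall s t, s \in D -> t \in D -> (s >=< t)%O.

Lemma val_full_flag D : chain_set D -> val (full_flag D) = full_block D.
Proof.
move=> cD; rewrite val_insubd; case: ifP => // /negP[].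
by rewrite /= inE; apply/is_flagP => p q; rewrite !inE; exact: cD.
Qed.

Lemma full_flag_mono D E : chain_set D -> chain_set E -> D \subset E ->
  (full_flag D <= full_flag E)%O.
Proof.
move=> cD cE /fintype.subsetP DE; rewrite flag_leE !val_full_flag//.
by apply/fintype.subsetP => p; rewrite !inE; exact: DE.
Qed.

Lemma colors_full_flag D s : chain_set D -> s \in D -> c s \subset colors (full_flag D).
Proof.
move=> cD sD; apply/fintype.subsetP => u us; apply/imsetP.
by exists (exist _ (u, s) us : flag_vertex); rewrite // val_full_flag// inE.
Qed.

Lemma heights_full_flag D s : chain_set D ->
  s \in heights (full_flag D) -> s = \bot%O \/ s \in D.
Proof.
move=> cD; rewrite !inE => /predU1P[->|/imsetP[p + ->]]; first by left.
by rewrite val_full_flag// inE; right.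
Qed.

Definition fill A : K := full_flag (heights A).

Lemma fill_mono : {homo fill : A B / (A <= B)%O}.
Proof.
by move=> A B AB; apply: full_flag_mono; [exact: heights_chain.. | exact: heights_mono].
Qed.

Lemma le_fill A : (A <= fill A)%O.
Proof.
rewrite flag_leE val_full_flag; last exact: heights_chain.
by apply/fintype.subsetP => p pA; rewrite inE mem_heights.
Qed.

Section FlagRealization.
Variable R : realType.
Local Notation P := (realization_space R S).
Local Notation PK := (realization_space R K).

Lemma superlevel_chain (x : P) D : superlevel x D -> chain_set D.
Proof. by move=> [_ xD _] s t /xD xs /xD xt; exact: coord_chain xs xt. Qed.

Lemma full_flag_superlevel_chain (x : P) D E :
  superlevel_weight D x != 0 -> superlevel_weight E x != 0 ->
  (full_flag D >=< full_flag E)%O.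
Proof.
move=> /superlevel_weightP xD /superlevel_weightP xE.
have cD := superlevel_chain xD; have cE := superlevel_chain xE.
rewrite /Order.comparable; case: (superlevel_nested xD xE).
  by move/(full_flag_mono cD cE) => ->.
by move/(full_flag_mono cE cD) => ->; rewrite orbT.
Qed.

Definition to_flags : P -> PK :=
  weighted_map (w := @superlevel_weight R _ S) (l := full_flag)
    (@superlevel_weight_ge0 R _ S) (@superlevel_ex R _ S) full_flag_superlevel_chain.

Lemma to_flags_neq0 x A : coord (to_flags x) A != 0 ->
  exists2 D, superlevel x D & A = full_flag D.
Proof. by move/weighted_map_neq0 => [D <- /superlevel_weightP xD]; exists D. Qed.

Lemma continuous_to_flags : continuous to_flags.
Proof. by apply: continuous_weighted => D; exact: continuous_superlevel_weight. Qed.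

(** Every element of a superlevel set supports x and gives all its colours to the
    simplex attached to that set. *)
Lemma to_flags_labels : keeps_labels c colors id to_flags.
Proof.
move=> x _ /to_flags_neq0[D xD ->]; have cD := superlevel_chain xD.
case: xD => /set0Pn[s sD] xD _; exists s; first exact: xD.
exact: colors_full_flag.
Qed.

Definition from_flags : PK -> P := monotone_map R top_height_mono.

Lemma from_flags_neq0 x s : coord (from_flags x) s != 0 ->
  exists2 A, top_height A = s & coord x A != 0.
Proof. exact: monotone_map_neq0. Qed.

Lemma from_flags_labels : keeps_labels colors c id from_flags.
Proof.
by move=> x _ /from_flags_neq0[A <- xA]; exists A => //; exact: colors_top_height.
Qed.

(** The height of the simplex attached to a superlevel set D belongs to D, unless no
    element of D has a colour and the height is \bot. In both cases it forms a
    chain with the support of x. *)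
Lemma from_to_flags_homotopic : label_homotopic c c (from_flags \o to_flags) id.
Proof.
apply: label_homotopic_line.
- apply: (@continuous_compose _ PK P).
    exact: continuous_monotone.
  exact: continuous_to_flags.
- by move=> x; exact: cvg_id.
- move=> x s /from_flags_labels[A /to_flags_labels[t xt tA] As].
  by exists t => //; exact: fintype.subset_trans As.
- by move=> x s xs; exists s.
move=> x s t /from_flags_neq0[_ <- /to_flags_neq0[D xD ->]] xt.
have cD := superlevel_chain xD.
have [->|] := heights_full_flag cD (top_height_mem (full_flag D)).
  by rewrite /Order.comparable le0x.
by case: xD => _ xD _ /xD xs; exact: coord_chain xs xt.
Qed.

Lemma heights_subset (x : PK) A B : coord x A != 0 -> coord x B != 0 ->
  heights A \subset heights B \/ heights B \subset heights A.
Proof.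
by move=> xA xB; case/orP: (coord_chain xA xB) => /heights_mono; [left | right].
Qed.

Lemma heights_support_chain (x : PK) A B s t :
  coord x A != 0 -> coord x B != 0 -> s \in heights A -> t \in heights B ->
  (s >=< t)%O.
Proof.
move=> xA xB sA tB; case: (heights_subset xA xB) => /fintype.subsetP AB.
  exact: heights_chain (AB _ sA) tB.
exact: heights_chain sA (AB _ tB).
Qed.

(** Since the simplices supporting x are nested, the superlevel sets of these weights
    are the sets of heights of those simplices. *)
Definition height_weight (s : S) (x : PK) : R :=
  \sum_(A : K | s \in heights A) coord x A.

Lemma height_weight_ge0 s x : 0 <= height_weight s x.
Proof. by apply: sumr_ge0 => A _; exact: coord_ge0. Qed.

Lemma height_weight_neq0 s x : height_weight s x != 0 ->
  exists2 A, s \in heights A & coord x A != 0.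
Proof.
move=> w0; apply/exists_inP; apply: contraNT w0 => /exists_inPn x0.
by apply/eqP/big1 => A /x0 /negPn /eqP.
Qed.

Lemma height_weight_full s x :
  (forall A, coord x A != 0 -> s \in heights A) -> height_weight s x = 1.
Proof.
move=> sx; rewrite -(sum_coord x) [RHS](bigID (fun A => s \in heights A))/=.
rewrite [X in _ = _ + X]big1 ?addr0// => A; apply: contraNeq; exact: sx.
Qed.

Lemma height_weight_le1 s x : height_weight s x <= 1.
Proof.
rewrite -(sum_coord x) [leRHS](bigID (fun A => s \in heights A))/= lerDl.
by apply: sumr_ge0 => A _; exact: coord_ge0.
Qed.

Lemma height_weight_lt s t x : height_weight t x < height_weight s x ->
  exists A, [/\ coord x A != 0, s \in heights A & t \notin heights A].
Proof.
move=> ts; suff /existsP[A /and3P[]] :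
    [exists A : K, [&& coord x A != 0, s \in heights A & t \notin heights A]].
  by exists A.
apply: contraTT ts; rewrite negb_exists => /forallP x0; rewrite -leNgt.
rewrite /height_weight [leLHS]big_mkcond [leRHS]big_mkcond/=.
apply: ler_sum => A _; have := x0 A; case: ifP => sA; last by case: ifP; rewrite ?coord_ge0.
by case: ifP => // tA; rewrite /= andbT negbK => /eqP ->.
Qed.

Lemma height_weight_ex x : exists s, height_weight s x != 0.
Proof.
exists \bot%O; rewrite height_weight_full ?oner_eq0// => A _; exact: bot_heights.
Qed.

Lemma height_weight_chain x s t :
  height_weight s x != 0 -> height_weight t x != 0 -> (s >=< t)%O.
Proof.
move=> /height_weight_neq0[A sA xA] /height_weight_neq0[B tB xB].
exact: heights_support_chain xA xB sA tB.
Qed.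

Definition spread : PK -> P :=
  weighted_map (w := height_weight) (l := id)
    height_weight_ge0 height_weight_ex height_weight_chain.

Lemma coord_spread x s :
  coord (spread x) s = height_weight s x / \sum_t height_weight t x.
Proof. by rewrite coord_weighted /weighted_coord big_pred1_eq. Qed.

Lemma coord_spread_le x s t :
  (coord (spread x) s <= coord (spread x) t) = (height_weight s x <= height_weight t x).
Proof.
rewrite !coord_spread ler_pM2r// invr_gt0.
exact: (weight_total_gt0 height_weight_ge0 height_weight_ex).
Qed.

Lemma coord_spread_lt x s t :
  (coord (spread x) s < coord (spread x) t) = (height_weight s x < height_weight t x).
Proof. by rewrite !ltNge coord_spread_le. Qed.

Lemma spread_neq0 x s : coord (spread x) s != 0 ->
  exists2 A, s \in heights A & coord x A != 0.
Proof. by move/weighted_map_neq0 => [t <-]; exact: height_weight_neq0. Qed.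

Lemma continuous_spread : continuous spread.
Proof.
apply: continuous_weighted => s; apply: continuous_real_sum => A.
exact: continuous_coord.
Qed.

Lemma superlevel_spread x D : superlevel (spread x) D ->
  exists2 A, coord x A != 0 & D = heights A.
Proof.
move=> [D0 xD xDC].
pose Q := [pred A : K | (coord x A != 0) && (D \subset heights A)].
have [M [xM Mmax]] : exists M, coord x M != 0 /\ forall A, coord x A != 0 -> (A <= M)%O.
  by have [A0 xA0] := coord_neq0_ex x; exact: chain_max (@coord_chain _ _ _ x) _ xA0.
have QM : Q M.
  rewrite /= xM; apply/fintype.subsetP => s /xD /spread_neq0[A sA xA].
  by apply: fintype.subsetP sA; apply: heights_mono; exact: Mmax.
have Qchain A B : Q A -> Q B -> (A >=< B)%O.
  by move=> /andP[xA _] /andP[xB _]; exact: coord_chain xA xB.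
have [A [/andP[xA DA] Amin]] := chain_min Qchain QM.
exists A => //; apply/eqP; rewrite finset.eqEsubset DA/=.
apply/fintype.subsetP => t tA; apply: contraT => tD.
(* Every s in D weighs more than t, so that some supporting simplex has height s
   but not t. The largest supporting simplex B without height t therefore has all
   heights in D, whence A <= B by minimality of A, and t is a height of B. *)
have lt_t s : s \in D -> exists B, [/\ coord x B != 0, s \in heights B & t \notin heights B].
  by move=> sD; apply: height_weight_lt; rewrite -coord_spread_lt; exact: xDC.
pose Q' := [pred B : K | (coord x B != 0) && (t \notin heights B)].
have Q'chain B C : Q' B -> Q' C -> (B >=< C)%O.
  by move=> /andP[xB _] /andP[xC _]; exact: coord_chain xB xC.
have [s0 s0D] := set0Pn _ D0; have [B0 [xB0 _ tB0]] := lt_t s0 s0D.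
have Q'B0 : Q' B0 by rewrite /= xB0.
have [B [/andP[xB tB] Bmax]] := chain_max Q'chain Q'B0.
have AB : (A <= B)%O.
  apply: Amin; rewrite /= xB; apply/fintype.subsetP => s /lt_t[C [xC sC tC]].
  by apply: fintype.subsetP sC; apply: heights_mono; apply: Bmax; rewrite /= xC.
by rewrite (fintype.subsetP (heights_mono AB) _ tA) in tB.
Qed.

Lemma colors_fill A : colors A \subset colors (fill A).
Proof. by apply: colors_mono; exact: le_fill. Qed.

(** By superlevel_spread both maps take values supported on the simplices fill A with
    A in the support of x, and these form a chain. *)
Lemma fill_spread_homotopic :
  label_homotopic colors colors (monotone_map R fill_mono) (to_flags \o spread).
Proof.
apply: label_homotopic_line.
- exact: continuous_monotone.
- by apply: continuous_compose; [exact: continuous_to_flags | exact: continuous_spread].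
- move=> x _ /monotone_map_neq0[A <- xA]; exists A => //; exact: colors_fill.
- move=> x _ /to_flags_neq0[D /superlevel_spread[A xA ->] ->].
  by exists A => //; exact: colors_fill.
move=> x _ _ /monotone_map_neq0[A <- xA] /to_flags_neq0[D /superlevel_spread[B xB ->] ->].
by case/orP: (coord_chain xA xB) => /fill_mono; rewrite /Order.comparable => ->;
  rewrite ?orbT.
Qed.

Lemma spread_from_flags_chain x s t :
  coord (spread x) s != 0 -> coord (from_flags x) t != 0 -> (s >=< t)%O.
Proof.
move=> /spread_neq0[A sA xA] /from_flags_neq0[B <- xB].
exact: heights_support_chain xA xB sA (top_height_mem B).
Qed.

(** The straight line between spread x and from_flags x may leave the region where
    labels are kept, but its superlevel sets do not. If A is the smallest simplex supporting x, then top_height A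
    is a height of all supporting simplices and gets the largest weight in
    spread x, whereas from_flags x vanishes below top_height A. So a superlevel set
    of a point of the line contains top_height A as soon as it has an element below
    top_height A; in any case it has an element s with top_height A <= s, and the
    simplex attached to it has all colours of A. *)
Lemma spread_from_flags_homotopic :
  label_homotopic colors colors (to_flags \o spread) (to_flags \o from_flags).
Proof.
exists (to_flags \o line_map spread_from_flags_chain); split.
- apply: continuous_compose; first exact: continuous_to_flags.
  by apply: continuous_line; [exact: continuous_spread | exact: continuous_monotone].
- move=> p _ /to_flags_neq0[D pD ->]; have cD := superlevel_chain pD.
  case: pD => /set0Pn[t tD] pD pDC; set x := p.1.
  have [A xA Amin] := coord_min x; exists A => //; set m := top_height A.
  suff [s sD ms] : exists2 s, s \in D & (m <= s)%O.
    apply: fintype.subset_trans (colors_top_height A) _.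
    by apply: fintype.subset_trans (c_mono ms) _; exact: colors_full_flag.
  (* m is a height of every supporting simplex, so its height_weight is 1. *)
  have mB B : coord x B != 0 -> m \in heights B.
    move=> /Amin /heights_mono /fintype.subsetP; apply; exact: top_height_mem.
  have [B xB tB] : exists2 B, coord x B != 0 & t \in heights B.
    have /line_map_neq0[/spread_neq0[B tB xB]|/from_flags_neq0[B <- xB]] := pD t tD.
      by exists B.
    by exists B => //; exact: top_height_mem.
  have /orP[mt|tm] := heights_support_chain xA xB (top_height_mem A) tB.
    by exists t.
  exists m => //; apply: contraT => mD; have := pDC t m tD mD.
  have {}tm : (t < m)%O.
    by rewrite lt_neqAle tm andbT; apply: contraNneq mD => <-.
  rewrite !coord_point_of /line_coord ltNge => /negP[].
  have -> : coord (from_flags x) t = 0.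
    apply/eqP; apply: contraTT tm => /from_flags_neq0[C <- xC].
    by rewrite le_gtF// top_height_max// mB.
  rewrite mulr0 addr0; apply: ler_wpDr.
    by rewrite mulr_ge0 ?clamp_ge0 ?coord_ge0.
  apply: ler_wpM2l; first by rewrite subr_ge0 clamp_le1.
  by rewrite coord_spread_le [leRHS]height_weight_full ?height_weight_le1.
- by move=> x; rewrite /= line_map0.
- by move=> x; rewrite /= line_map1.
Qed.

Lemma to_from_flags_homotopic :
  label_homotopic colors colors (to_flags \o from_flags) id.
Proof.
apply: label_homotopic_sym; apply: label_homotopic_trans spread_from_flags_homotopic.
apply: label_homotopic_trans fill_spread_homotopic.
have id_mono : {homo (@id K) : A B / (A <= B)%O} by [].
rewrite (_ : id = monotone_map R id_mono); last first.
  by apply/funext => x; apply: coord_inj => A; rewrite coord_monotone big_pred1_eq.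
by apply: label_homotopic_monotone => A; [exact: le_fill | | exact: colors_fill].
Qed.

End FlagRealization.
End FlagComplex.

(** * Bases of free abelian groups *)

Lemma Zbasis_mulmx (I : finType) k l (b : I -> 'rV[int]_k) (e : I -> 'rV[int]_l) :
  Zbasis b -> exists M : 'M[int]_(k, l), forall i, b i *m M = e i.
Proof.
move=> bP; pose coef x := projT1 (cid (bP x)).
have coefE x : x = \sum_i coef x i *: b i by case: (projT2 (cid (bP x))).
have coef_uniq x (a : {ffun I -> int}) : x = \sum_i a i *: b i -> coef x = a.
  by case: (projT2 (cid (bP x))) => _; exact.
(* Row i is the image of the i-th unit vector, expanded in the basis b. *)
exists (\matrix_(i < k) \sum_v coef (delta_mx 0 i) v *: e v) => i.
pose a := [ffun v => \sum_j b i 0 j * coef (delta_mx 0 j) v].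
have : [ffun v => (v == i)%:R] = a.
  transitivity (coef (b i)); first (apply/esym/coef_uniq).
    rewrite (bigD1 i)//= ffunE eqxx scale1r big1 ?addr0// => v vi.
    by rewrite ffunE (negbTE vi) scale0r.
  apply: coef_uniq; rewrite [LHS]row_sum_delta.
  under [RHS]eq_bigr => v _ do rewrite ffunE scaler_suml.
  rewrite exchange_big; apply: eq_bigr => j _ /=.
  rewrite [X in _ *: X = _]coefE scaler_sumr.
  by apply: eq_bigr => v _; rewrite scalerA.
move=> aE; rewrite mulmx_sum_row.
transitivity (\sum_v a v *: e v); last first.
  rewrite -aE (bigD1 i)//= ffunE eqxx scale1r big1 ?addr0// => v vi.
  by rewrite ffunE (negbTE vi) scale0r.
under [RHS]eq_bigr => v _ do rewrite ffunE scaler_suml.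
rewrite [RHS]exchange_big; apply: eq_bigr => j _ /=; rewrite rowK scaler_sumr.
by apply: eq_bigr => v _; rewrite scalerA.
Qed.

Lemma Zbasis_mulmx_id (I : finType) k (b : I -> 'rV[int]_k) (A : 'M[int]_k) :
  Zbasis b -> (forall i, b i *m A = b i) -> A = 1%:M.
Proof.
move=> bP bA; apply/row_matrixP => i; rewrite rowE row1.
have [a [-> _]] := bP (delta_mx 0 i); rewrite mulmx_suml.
by apply: eq_bigr => j _; rewrite -scalemxAl bA.
Qed.

(** * The moment-angle complex as a space over the flag complex *)

Section ColorClasses.
Variables (d : Order.disp_t) (S : finBPOrderType d) (U : finType).
Variable c : S -> {set U}.

Definition color_partition : {set {set flag_vertex c}} :=
  preim_partition (@flag_color _ _ _ c) [set: flag_vertex c]%SET.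

Lemma color_partitionP :
  finset.partition color_partition [set: flag_vertex c]%SET.
Proof. exact: preim_partitionP. Qed.

Definition color_class (u : U) : {set flag_vertex c} :=
  [set p | flag_color p == u]%SET.

Lemma mem_color_partition A : reflect
  (exists p : flag_vertex c, A = color_class (flag_color p)) (A \in color_partition).
Proof.
apply: (iffP imsetP) => [[p _ ->]|[p ->]]; exists p; rewrite ?inE//;
  by apply/setP => q; rewrite !inE eq_sym.
Qed.

End ColorClasses.

(* From here on the notations of finite sets prevail over those of classical sets. *)
Import mathcomp.boot.finset.
Local Close Scope classical_set_scope.

Theorem theorem4p2 (R : realType) (d : Order.disp_t) (S : finBPOrderType d)
    (S_simplicial : simplicial_poset S) :
  exists (V : finType) (K : simplicial_complex V) (alpha : {set {set V}}),
    partition alpha [set: V] /\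
    forall (lambdaS : poset_vertex S -> 'rV[int]_#|poset_vertices S|)
        (e : {A : {set V} | A \in alpha} -> 'rV[int]_#|alpha|)
        (lambda_alpha : V -> 'rV[int]_#|alpha|),
      Zbasis lambdaS -> Zbasis e ->
      (forall (A : {A : {set V} | A \in alpha}) (v : V), v \in val A -> lambda_alpha v = e A) ->
      homotopy_equivalent R
        (moment_angle_complex R lambdaS) (X_space R K lambda_alpha).
Proof.
pose c := @vertices_of d S; pose V := flag_vertex c.
have c_mono s t : (s <= t)%O -> c s \subset c t by exact: vertices_ofS.
exists V, (flag_complex c), (color_partition c).
split=> [|lambdaS e lambda_alpha lambdaSP eP lambda_alphaE].
  exact: color_partitionP.
have cu (u : poset_vertex S) : u \in c (val u) by rewrite inE.
(* A vertex u of S has colour class cls u, nonempty because it contains (u, u). *)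
pose vertex u : V := exist _ (u, val u) (cu u).
have classP u : color_class c u \in color_partition c.
  by apply/mem_color_partition; exists (vertex u).
pose cls u : {A : {set V} | A \in color_partition c} := exist _ (color_class c u) (classP u).
have clsP A : exists u, cls u == A.
  have /mem_color_partition[p pA] := valP A.
  by exists (flag_color p); rewrite -val_eqE /= -pA.
have cls_inj : injective cls.
  move=> u v /(congr1 val)/= /setP/(_ (vertex u)); rewrite !inE eqxx => /esym/eqP.
  by [].
pose color A := xchoose (clsP A).
have clsK A : cls (color A) = A by exact/eqP/(xchooseP (clsP A)).
have colorK u : color (cls u) = u by apply: cls_inj; rewrite clsK.
have lambdaE (p : V) : lambda_alpha p = e (cls (flag_color p)).
  by apply: lambda_alphaE; rewrite inE.
have [M ME] := Zbasis_mulmx (e \o cls) lambdaSP.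
have [N NE] := Zbasis_mulmx (lambdaS \o color) eP.
have MN : M *m N = 1%:M.
  by apply: (Zbasis_mulmx_id lambdaSP) => u; rewrite mulmxA ME NE /= colorK.
have NM : N *m M = 1%:M.
  by apply: (Zbasis_mulmx_id eP) => A; rewrite mulmxA NE ME /= clsK.
have color_ex (u : poset_vertex S) (A : simplex (flag_complex c)) :
    u \in colors A -> exists2 p, p \in val A & u = flag_color p.
  by move/imsetP => [p]; exists p.
have color_in (p : V) (A : simplex (flag_complex c)) :
    p \in val A -> flag_color p \in colors A by exact: imset_f.
rewrite /moment_angle_complex /X_space.
refine (@identification_equivalence R (poset_vertex S) _ _ S (simplex (flag_complex c))
  _ _ c (@colors _ _ _ c) (fun s => isotropy R lambdaS (vertices_of s))
  (fun A => isotropy R lambda_alpha (val A)) _ _ _ _ _ _ _ _ M N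
  (@to_flags _ _ _ c R) (@from_flags _ _ _ c R) _ _ _ _ _ _ _ _ _ _) => //.
- exact: colors_mono.
- by move=> s t; exact: isotropyS.
- move=> A B /fintype.subsetP AB g Ag; rewrite -(tpow1 g).
  apply: isotropy_tpow Ag => p /color_in /AB /color_ex[q qB pq].
  by exists q => //; rewrite mulmx1 !lambdaE pq.
- move=> s A g /fintype.subsetP sA; apply: isotropy_tpow => u /sA /color_ex[p pA ->].
  by exists p => //; rewrite ME lambdaE.
- move=> A s g /fintype.subsetP As; apply: isotropy_tpow => p /color_in /As us.
  by exists (flag_color p) => //; rewrite lambdaE NE /= colorK.
- exact: continuous_to_flags.
- exact: continuous_monotone.
- exact: to_flags_labels.
- exact: from_flags_labels.
- exact: from_to_flags_homotopic.
- exact: to_from_flags_homotopic.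
Qed.
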